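(* Let $X$ be a transient Markov chain on $\mathbf{Z}^d$, independent of the fractal percolation, and let $p\in(0,1]$. For every nonrandom $F\subseteq\mathbf{Z}^d$ and every $a\in\mathbf{Z}^d$, $$\tfrac12\,c_p(F;a)\ \le\ \mathbb{P}^a\{X_n\in\Pi_p\cap F\text{ for some }n\ge0\}\ \le\ 128\,c_p(F;a).$$
   Context: For integers $k\ge 0$ let $\mathcal{V}_k:=[-2^k,2^k)^d\subset\mathbf{R}^d$, $\mathcal{S}_0:=\mathcal{V}_0$ and $\mathcal{S}_{k+1}:=\mathcal{V}_{k+1}\setminus\mathcal{V}_k$. For $n\in\mathbf{Z}$, $\mathcal{D}_n$ denotes the set of dyadic cubes $\prod_{i=1}^d[j_i2^n,(j_i+1)2^n)$ with $(j_1,\dots,j_d)\in\mathbf{Z}^d$. Macroscopic fractal percolation: on a probability space $(\Omega,\mathcal{F},\mathbb{P})$, for each integer $k\ge0$ let $\{U_k(Q)\}$ be i.i.d. Uniform$(0,1)$ random variables indexed by the dyadic cubes $Q\subseteq\mathcal{V}_k$ with $Q\in\mathcal{D}_j$ for some $0\le j\le k$, the families for different $k$ being independent. For $x\in\mathcal{V}_k\cap\mathbf{Z}^d$ and $1\le i\le k+1$ let $Q^{(k)}_i(x)$ be the unique cube of $\mathcal{D}_{k+1-i}$ containing $x$. For $p\in(0,1]$, $\Pi_p\subseteq\mathbf{R}^d$ is the union, over all $k\ge0$ and all $x\in\mathbf{Z}^d\cap\mathcal{S}_k$ such that $U_k(Q^{(k)}_i(x))<p$ for every $i=1,\dots,k+1$,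 of the unit cubes $[x_1,x_1+1)\times\cdots\times[x_d,x_d+1)$. For $x,y\in\mathbf{Z}^d\cap\mathcal{S}_k$ define $\mathrm{d}(x,y):=\#\{i\in\{1,\dots,k+1\}:Q^{(k)}_i(x)=Q^{(k)}_i(y)\}$. Write $x\leftrightarrow y$ if $x,y$ lie in the same shell $\mathcal{S}_k$, and $x\not\leftrightarrow y$ otherwise. Markov chain setting: $X=\{X_n\}_{n\ge0}$ is a Markov chain on $\mathbf{Z}^d$ with laws $P^a$ under which $X_0=a$; its Green function $g(a,x):=\sum_{n\ge0}P^a\{X_n=x\}$ is finite for all $a,x$ (transience). $X$ and the percolation are independent, and $\mathbb{P}^a:=P^a\times\mathbb{P}$. For a probability measure $\mu$ on $\mathbf{Z}^d$ (write $\mu(z):=\mu(\{z\})$), $a\in\mathbf{Z}^d$ and $p\in(0,1]$ define $I(\mu;a):=\sum\sum_{x,y:\,x\not\leftrightarrow y}\frac{g(x,y)}{g(a,y)}\mu(x)\mu(y)$ and $I_p(\mu;a):=\sum\sum_{x,y:\,x\leftrightarrow y}\frac{g(x,y)}{g(a,y)}p^{-\mathrm{d}(x,y)}\mu(x)\mu(y)$, with conventions $c/0=\infty$ for $c>0$ and $0/0=0$. The Martin $p$-capacity of $F\subseteq\mathbf{Z}^d$ is $c_p(F;a):=\sup_{F_0\subseteq F,\ F_0\text{ finite}}\big[\inf_{\mu\in M_1(F_0)}\{I(\mu;a)+I_p(\mu;a)\}\big]^{-1}$, where $M_1(F_0)$ is the set of probability measures on $F_0$ (and $1/\infty=0$,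 $1/0=\infty$, $\inf\varnothing=\infty$). *)

(* Defs.v *)
From HB Require Import structures.
From mathcomp Require Import all_boot all_order all_algebra.
From mathcomp Require Import all_classical all_reals all_analysis.
Set Implicit Arguments. Unset Strict Implicit. Unset Printing Implicit Defensive.
Import Order.TTheory GRing.Theory Num.Theory.
Local Open Scope classical_set_scope.
Local Open Scope ring_scope.

Definition Zd (dim : nat) := {ffun 'I_dim -> int}.

Definition inV (dim k : nat) (x : Zd dim) : bool :=
  [forall i, (- (2 ^ k)%:Z <= x i) && (x i < (2 ^ k)%:Z)].

Definition inS (dim k : nat) (x : Zd dim) : bool :=
  inV k x && (if k is k'.+1 then ~~ inV k' x else true).

(* the least k with x \in V_k (searched in a range that surely contains it);
   x then lies in the shell S_(shell x) *)
Definition shell (dim : nat) (x : Zd dim) : nat :=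
  find (fun k => inV k x) (iota 0 (\sum_(i < dim) `|x i|%N).+1).

Definition sameshell (dim : nat) (x y : Zd dim) : bool :=
  inS (shell x) x && inS (shell x) y.

(* integer coordinates (j_1..j_dim) of the cube of D_j containing x *)
Definition cubeidx (dim j : nat) (x : Zd dim) : Zd dim :=
  [ffun i => ((x i) %/ (2 ^ j)%:Z)%Z].

(* d(x,y) = #{i in 1..k+1 : Q_i^(k)(x) = Q_i^(k)(y)}, k the shell of x;
   Q_i^(k)(x) is in D_(k+1-i), i.e. j = k+1-i ranges over 0..k *)
Definition dd (dim : nat) (x y : Zd dim) : nat :=
  count (fun j => cubeidx j x == cubeidx j y) (iota 0 (shell x).+1).

(* index (k, j, v) of the variable U_k(Q), Q = prod_i [v_i 2^j, (v_i+1) 2^j) *)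
Definition idx (dim : nat) := (nat * nat * Zd dim)%type.

Definition valid_idx (dim : nat) (q : idx dim) : bool :=
  let: (k, j, v) := q in
  (j <= k)%N &&
  [forall i, (- (2 ^ k)%:Z <= v i * (2 ^ j)%:Z) &&
             ((v i + 1) * (2 ^ j)%:Z <= (2 ^ k)%:Z)].

(* the lattice points x whose unit cube belongs to Pi_p, for the
   outcome w of the uniforms U : idx -> T -> R *)
Definition PiP (R : realType) (T : Type) (dim : nat) (p : R)
  (U : idx dim -> T -> R) (w : T) : set (Zd dim) :=
  [set x | forall j, (j <= shell x)%N -> U (shell x, j, cubeidx j x) w < p].

Definition unifcdf (R : realType) (t : R) : R := Num.min 1 (Num.max 0 t).

Definition pathprob (R : realType) (dim : nat) (K : Zd dim -> Zd dim -> R)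
  (a : Zd dim) (xs : seq (Zd dim)) : R :=
  match xs with
  | [::] => 1
  | x0 :: rest => (x0 == a)%:R * \prod_(i < size rest) K (nth a xs i) (nth a rest i)
  end.

Local Open Scope ereal_scope.

Fixpoint nstep (R : realType) (dim : nat) (K : Zd dim -> Zd dim -> R) (n : nat)
  (x y : Zd dim) : \bar R :=
  match n with
  | 0 => ((x == y)%:R)%:E
  | n'.+1 => \esum_(z in [set: Zd dim]) ((K x z)%:E * nstep K n' z y)
  end.

Definition green (R : realType) (dim : nat) (K : Zd dim -> Zd dim -> R)
  (x y : Zd dim) : \bar R :=
  \esum_(n in [set: nat]) nstep K n x y.

(* c / e with c/0 = oo for c > 0 and 0/0 = 0 (both arguments finite, >= 0) *)
Definition eratio (R : realType) (c e : \bar R) : \bar R :=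
  if e == 0 then (if c == 0 then 0 else +oo) else (fine c / fine e)%:E.

Definition einv (R : realType) (e : \bar R) : \bar R :=
  if e == +oo then 0 else if e == 0 then +oo else (fine e)^-1%:E.

(* mu is a probability measure on the finite set F0 (a duplicate-free list) *)
Definition M1 (R : realType) (dim : nat) (F0 : seq (Zd dim)) (mu : Zd dim -> R) : Prop :=
  (forall x, (0 <= mu x)%R) /\ (forall x, x \notin F0 -> mu x = 0%R) /\
  (\sum_(x <- F0) mu x)%R = 1%R.

(* I(mu;a): pairs in different shells (mu is supported by F0) *)
Definition energyI (R : realType) (dim : nat) (K : Zd dim -> Zd dim -> R)
  (F0 : seq (Zd dim)) (mu : Zd dim -> R) (a : Zd dim) : \bar R :=
  \sum_(x <- F0) \sum_(y <- F0 | ~~ sameshell x y)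
     eratio (green K x y) (green K a y) * (mu x * mu y)%:E.

Definition energyIp (R : realType) (dim : nat) (K : Zd dim -> Zd dim -> R)
  (p : R) (F0 : seq (Zd dim)) (mu : Zd dim -> R) (a : Zd dim) : \bar R :=
  \sum_(x <- F0) \sum_(y <- F0 | sameshell x y)
     eratio (green K x y) (green K a y) * (p ^- dd x y * mu x * mu y)%:E.

Definition capacity (R : realType) (dim : nat) (K : Zd dim -> Zd dim -> R)
  (p : R) (F : set (Zd dim)) (a : Zd dim) : \bar R :=
  ereal_sup [set einv (ereal_inf [set energyI K F0 mu a + energyIp K p F0 mu a
                                  | mu in M1 F0])
            | F0 in [set F0 : seq (Zd dim) | uniq F0 /\ (forall x, x \in F0 -> F x)]].

(* Main.v *)
(** Both bounds are reduced to finite targets [F0] and finite time horizons,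
    where all expectations are finite sums over the traces of the chain on [F0]
    and the open/closed configurations of the cubes that meet [F0].  Writing
    [A x] for the set of cubes containing [x], the two energies merge into
    [sum g(x,y)/g(a,y) p^-|A x inter A y| mu(x) mu(y)].

    Let [Z] be the number of visits to open points, each point [y] weighted by
    [mu(y) / (g(a,y) p^|A y|)].  The lower bound is the second moment method:
    [E Z] is close to [1] and [E Z^2] is at most twice the energy.

    For the upper bound let [mu] be the law of the first open point [x] hit by
    the chain, and [h] its mass.  Order the points lexicographically along the
    nested cubes, let [D x] be the cubes met by the points up to [x], and let
    [S] be the sum over [x] of [E[1{first hit at x} | chain, D x]].  Expanding
    the square and using the tower property gives [E S^2 <= 4 h] (the dual form
    of Doob's inequality).  On the other hand the strong Markov property and the
    convexity of the cubes in the order bound [E[Z S]] from below by the part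
    of the energy carried by pairs [x <= y], up to the truncation of [g].
    Doing the same with the reverse order and comparing with
    [E Z^2 <= 2 energy] yields [energy <= 128 h]. *)

Require Import Defs.
From HB Require Import structures.
From mathcomp Require Import all_boot all_order all_algebra.
From mathcomp Require Import all_classical all_reals all_analysis.
From mathcomp Require Import ring lra zify.
Set Implicit Arguments. Unset Strict Implicit. Unset Printing Implicit Defensive.
Import Order.TTheory GRing.Theory Num.Theory.
Local Open Scope classical_set_scope.
Local Open Scope ring_scope.

(** * Bernoulli configurations *)

Section Bernoulli.
Variables (R : realFieldType) (C : finType) (p : R).
Local Notation cfg := {ffun C -> bool}.

Definition bern (o : cfg) : R := \prod_c (if o c then p else 1 - p).

Definition Ebern (f : cfg -> R) : R := \sum_o bern o * f o.

Definition opens (s : {set C}) (o : cfg) : bool := [forall c in s, o c].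

Definition mix (D : {set C}) (o o' : cfg) : cfg :=
  [ffun c => if c \in D then o c else o' c].

(** Conditional expectation given the coordinates in [D]: under the product law it amounts to
    resampling all the others. *)
Definition condE (D : {set C}) (f : cfg -> R) (o : cfg) : R :=
  Ebern (fun o' => f (mix D o o')).

Lemma Ebern_prod (f : C -> bool -> R) :
  Ebern (fun o => \prod_c f c (o c)) = \prod_c (p * f c true + (1 - p) * f c false).
Proof.
transitivity (\prod_c \sum_b (if b then p else 1 - p) * f c b).
  rewrite bigA_distr_bigA; apply: eq_bigr => o _.
  by rewrite /bern -big_split.
by apply: eq_bigr => c _; rewrite big_bool.
Qed.

Lemma opensE s o : (opens s o)%:R = \prod_c (if c \in s then (o c)%:R else 1) :> R.
Proof.
rewrite -big_mkcond /=; case: (boolP (opens s o)) => [/forall_inP h|].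
  by rewrite big1 // => c /h ->.
case/forall_inPn => c cs /negbTE oc; rewrite (bigD1 c) //= oc mul0r //.
Qed.

Lemma Ebern1 : Ebern (fun=> 1) = 1.
Proof.
transitivity (Ebern (fun o => \prod_c (fun _ _ => 1 : R) c (o c))).
  by apply: eq_bigr => o _; rewrite big1.
by rewrite (Ebern_prod (fun _ _ => 1)) big1 // => c _; rewrite !mulr1 addrC subrK.
Qed.

Lemma Ebern_opens s : Ebern (fun o => (opens s o)%:R) = p ^+ #|s|.
Proof.
transitivity (Ebern (fun o => \prod_c (if c \in s then (o c)%:R else 1))).
  by apply: eq_bigr => o _; rewrite opensE.
rewrite (Ebern_prod (fun c b => if c \in s then b%:R else 1)).
rewrite -prodr_const [RHS]big_mkcond /=; apply: eq_bigr => c _.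
by case: ifP => _ /=; rewrite ?mulr1 ?mulr0 ?addr0 // addrC subrK.
Qed.

Lemma EbernZ k f : Ebern (fun o => k * f o) = k * Ebern f.
Proof. by rewrite /Ebern mulr_sumr; apply: eq_bigr => o _; rewrite mulrCA. Qed.

Lemma Ebern_sum (I : finType) (f : I -> cfg -> R) :
  Ebern (fun o => \sum_i f i o) = \sum_i Ebern (f i).
Proof. by rewrite /Ebern exchange_big; apply: eq_bigr => o _; rewrite mulr_sumr. Qed.

Lemma eq_Ebern f g : f =1 g -> Ebern f = Ebern g.
Proof. by move=> fg; apply: eq_bigr => o _; rewrite fg. Qed.

Hypotheses (p_gt0 : 0 < p) (p_le1 : p <= 1).

Lemma bern_ge0 o : 0 <= bern o.
Proof. by apply: prodr_ge0 => c _; case: ifP => _; rewrite ?subr_ge0 // ltW. Qed.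

Lemma Ebern_ge0 f : (forall o, 0 <= f o) -> 0 <= Ebern f.
Proof. by move=> h; apply: sumr_ge0 => o _; rewrite mulr_ge0 // bern_ge0. Qed.

Lemma le_Ebern f g : (forall o, f o <= g o) -> Ebern f <= Ebern g.
Proof. by move=> h; apply: ler_sum => o _; rewrite ler_wpM2l // bern_ge0. Qed.

Lemma condE_ge0 D f o : (forall o, 0 <= f o) -> 0 <= condE D f o.
Proof. by move=> h; apply: Ebern_ge0. Qed.

Lemma bern_mix D o o' : bern (mix D o o') * bern (mix D o' o) = bern o * bern o'.
Proof.
rewrite /bern -!big_split /=; apply: eq_bigr => c _.
by rewrite !ffunE; case: (c \in D) => //; rewrite mulrC.
Qed.

Lemma mixK D o o' : mix D (mix D o o') (mix D o' o) = o.
Proof. by apply/ffunP => c; rewrite !ffunE; case: (c \in D). Qed.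

(** Two independent configurations may exchange their coordinates outside [D]: this is an involution
    that preserves their joint law, and it carries one side to the other. *)
Lemma condE_adj D f g :
  Ebern (fun o => g o * condE D f o) = Ebern (fun o => condE D g o * f o).
Proof.
pose G (u : cfg * cfg) := bern u.1 * bern u.2 * (g u.1 * f (mix D u.1 u.2)).
pose s (u : cfg * cfg) := (mix D u.1 u.2, mix D u.2 u.1).
have sK : involutive s by case=> o o'; rewrite /s /= !mixK.
transitivity (\sum_u G u).
  rewrite -(pair_bigA _ (fun o o' => G (o, o'))) /=; apply: eq_bigr => o _.
  rewrite /condE /Ebern !mulr_sumr; apply: eq_bigr => o' _.
  by rewrite /G /=; ring.
rewrite (reindex_inj (can_inj sK)) /=.
rewrite -(pair_bigA _ (fun o o' => G (s (o, o')))) /=; apply: eq_bigr => o _.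
rewrite /condE /Ebern mulr_suml mulr_sumr; apply: eq_bigr => o' _.
by rewrite /G /= bern_mix mixK; ring.
Qed.

(** [condE D f] reads only coordinates in [D], so resampling outside the larger [D'] does not change
    it. *)
Lemma condE_tower (D D' : {set C}) f o :
  D \subset D' -> condE D' (condE D f) o = condE D f o.
Proof.
move=> /fintype.subsetP sD; rewrite {1}/condE.
transitivity (Ebern (fun=> 1) * condE D f o); last by rewrite Ebern1 mul1r.
rewrite /Ebern mulr_suml; apply: eq_bigr => o' _; rewrite mulr1; congr (_ * _).
apply: eq_bigr => o2 _; congr (_ * f _); apply/ffunP => c; rewrite !ffunE.
by case: ifP => // /sD ->.
Qed.

Lemma condE_opens D s o :
  condE D (fun o => (opens s o)%:R) o = (opens (s :&: D) o)%:R * p ^+ #|s :\: D|.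
Proof.
rewrite -Ebern_opens /Ebern mulr_sumr; apply: eq_bigr => o' _.
rewrite mulrCA -natrM mulnb; congr (_ * _%:R); congr nat_of_bool.
apply/forall_inP/andP => [h|[/forall_inP h1 /forall_inP h2] c cs].
  split; apply/forall_inP => c; rewrite !inE => /andP[].
    by move=> cs cD; have := h _ cs; rewrite ffunE cD.
  by move=> cD cs; have := h _ cs; rewrite ffunE (negbTE cD).
rewrite ffunE; case: ifPn => cD; first by apply: h1; rewrite !inE cs.
by apply: h2; rewrite !inE cs cD.
Qed.

End Bernoulli.

(** * Hitting an open point *)

(** Pairs of times are sorted by which comes first; the diagonal is counted twice, whence an
    inequality. *)
Lemma sum_mul_le_ordered (R : realFieldType) (u w : nat -> R) (L : nat) :
  (forall n, 0 <= u n) -> (forall n, 0 <= w n) ->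
  (\sum_(m < L) u m) * (\sum_(n < L) w n) <=
  \sum_(m < L) \sum_(j < L - m) u m * w (m + j)%N
  + \sum_(n < L) \sum_(j < L - n) w n * u (n + j)%N.
Proof.
move=> u0 w0.
have rec (f g : nat -> R) n : \sum_(m < n.+1) \sum_(j < n.+1 - m) f m * g (m + j)%N =
    \sum_(m < n) \sum_(j < n - m) f m * g (m + j)%N
    + (\sum_(m < n) f m) * g n + f n * g n.
  rewrite big_ord_recr /= subSnn big_ord1 addn0; congr (_ + _).
  rewrite mulr_suml -big_split /=; apply: eq_bigr => m _.
  by rewrite subSn ?(ltnW (ltn_ord m)) // big_ord_recr /= subnKC // ltnW.
elim: L => [|L IH]; first by rewrite !big_ord0 mul0r addr0.
rewrite !rec !big_ord_recr /=.
have := mulr_ge0 (u0 L) (w0 L).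
move: IH; set A := \sum_(i < L) u i; set B := \sum_(i < L) w i.
set D1 := \sum_(m < L) _; set D2 := \sum_(m < L) _.
rewrite mulrDl !mulrDr (mulrC B) (mulrC (w L)).
move: (A * B) (A * w L) (u L * B) (u L * w L) => *; lra.
Qed.

Lemma sum_shift_le (R : realFieldType) (u : nat -> R) (n M L : nat) :
  (forall k, 0 <= u k) -> (n + M <= L)%N ->
  \sum_(j < M) u (n + j)%N <= \sum_(k < L) u k.
Proof.
move=> u0 nML; rewrite -(subnKC nML) !big_split_ord /= -addrA addrCA lerDl.
by rewrite addr_ge0 // sumr_ge0.
Qed.

Section Hitting.
(** Abstract finite model: [S] is the target, [C] the cubes, [OX] the trajectories with weights [q].
    [V n v] is the target point occupied at time [n], or [None] off the target. [ka] and [ks] are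
    step probabilities from the start and between target points; [ga] and [gr] are the Green
    functions. *)
Variables (R : realFieldType) (C S OX : finType) (p : R).
Variables (anc : S -> {set C}) (q : OX -> R) (V : nat -> OX -> option S).
Variables (L : nat) (ka : nat -> S -> R) (ks : nat -> S -> S -> R).
Variables (ga : S -> R) (gr : S -> S -> R).
Local Notation cfg := {ffun C -> bool}.
Hypotheses (p_gt0 : 0 < p) (p_le1 : p <= 1) (q_ge0 : forall v, 0 <= q v).
Hypothesis trace1 : forall n x, (n < L)%N ->
  \sum_v q v * (V n v == Some x)%:R = ka n x.
(** The past enters only as avoidance of a set of positions: this is all that a first hitting time
    requires once the percolation is fixed. *)
Hypothesis trace_markov : forall n j x y (A : pred (option S)), (n + j < L)%N ->
  \sum_v q v * ([forall m : 'I_n, ~~ A (V m v)] && (V n v == Some x)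
                && (V (n + j)%N v == Some y))%:R =
  (\sum_v q v * ([forall m : 'I_n, ~~ A (V m v)] && (V n v == Some x))%:R)
  * ks j x y.
Hypotheses (ka_ge0 : forall n x, 0 <= ka n x) (ks_ge0 : forall n x y, 0 <= ks n x y).
Hypothesis ka_le : forall k x, \sum_(n < k) ka n x <= ga x.
Hypothesis ks_le : forall k x y, \sum_(n < k) ks n x y <= gr x y.

Definition jointE (F : OX -> cfg -> R) : R := \sum_v q v * Ebern p (F v).

Definition visits (v : OX) (y : S) : R := \sum_(n < L) (V n v == Some y)%:R.

(* mu y / ga y is 0 when ga y = 0. *)
Definition wt (mu : S -> R) (y : S) : R := mu y / ga y * p ^- #|anc y|.

Definition hitmass (mu : S -> R) (v : OX) (o : cfg) : R :=
  \sum_y wt mu y * visits v y * (opens (anc y) o)%:R.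

Definition energy (mu : S -> R) : R :=
  \sum_x \sum_y gr x y / ga y * p ^- #|anc x :&: anc y| * mu x * mu y.

Definition isopen (s : option S) (o : cfg) : bool :=
  if s is Some x then opens (anc x) o else false.

Definition hit (n : nat) (v : OX) (o : cfg) : bool :=
  [exists m : 'I_n, isopen (V m v) o].

(** An indicator: [hit n] concerns times strictly before [n], so at most one term of the sum is
    nonzero. *)
Definition firsthit (N : nat) (x : S) (v : OX) (o : cfg) : R :=
  \sum_(n < N) (~~ hit n v o && (V n v == Some x) && opens (anc x) o)%:R.

Lemma jointE_ge0 F : (forall v o, 0 <= F v o) -> 0 <= jointE F.
Proof. by move=> F0; apply: sumr_ge0 => v _; rewrite mulr_ge0 // Ebern_ge0. Qed.

Lemma le_jointE F G : (forall v o, F v o <= G v o) -> jointE F <= jointE G.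
Proof. by move=> h; apply: ler_sum => v _; rewrite ler_wpM2l // le_Ebern. Qed.

Lemma eq_jointE F G : (forall v o, F v o = G v o) -> jointE F = jointE G.
Proof. by move=> h; apply: eq_bigr => v _; rewrite (eq_Ebern _ (h v)). Qed.

Lemma jointEZ k F : jointE (fun v o => k * F v o) = k * jointE F.
Proof. by rewrite /jointE mulr_sumr; apply: eq_bigr => v _; rewrite EbernZ mulrCA. Qed.

Lemma jointE_sum (I : finType) (F : I -> OX -> cfg -> R) :
  jointE (fun v o => \sum_i F i v o) = \sum_i jointE (F i).
Proof.
rewrite /jointE exchange_big; apply: eq_bigr => v _.
by rewrite Ebern_sum mulr_sumr.
Qed.

Lemma jointED F G : jointE (fun v o => F v o + G v o) = jointE F + jointE G.
Proof.
rewrite /jointE -big_split; apply: eq_bigr => v _ /=; rewrite -mulrDr.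
congr (_ * _); rewrite /Ebern -big_split; apply: eq_bigr => o _ /=.
by rewrite mulrDr.
Qed.

Lemma ga_ge0 x : 0 <= ga x.
Proof. by have := ka_le 0 x; rewrite big_ord0. Qed.

Lemma gr_ge0 x y : 0 <= gr x y.
Proof. by have := ks_le 0 x y; rewrite big_ord0. Qed.

Lemma pow_ge0 n : 0 <= p ^+ n.
Proof. by rewrite exprn_ge0 // ltW. Qed.

Lemma powV_ge0 n : 0 <= p ^- n.
Proof. by rewrite invr_ge0 pow_ge0. Qed.

Lemma visits_ge0 v y : 0 <= visits v y.
Proof. by apply: sumr_ge0 => n _; rewrite ler0n. Qed.

Lemma wt_ge0 (mu : S -> R) y : 0 <= mu y -> 0 <= wt mu y.
Proof.
by move=> mu0; rewrite /wt !mulr_ge0 ?powV_ge0 // invr_ge0 ga_ge0.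
Qed.

(** * First and second moments of the weighted visits *)

Lemma visits_mean y : \sum_v q v * visits v y = \sum_(n < L) ka n y.
Proof.
rewrite /visits; under eq_bigr do rewrite mulr_sumr.
by rewrite exchange_big /=; apply: eq_bigr => n _; rewrite trace1.
Qed.

Lemma trace2 n j x y : (n + j < L)%N ->
  \sum_v q v * ((V n v == Some x)%:R * (V (n + j)%N v == Some y)%:R) =
  ka n x * ks j x y.
Proof.
(* With nothing to avoid, the condition on the past disappears. *)
move=> nj; have h := trace_markov x y pred0 nj.
have all_n v : [forall m : 'I_n, ~~ pred0 (V m v)] by apply/forallP.
rewrite -trace1; last exact: leq_ltn_trans (leq_addr _ _) nj.
transitivity (\sum_v q v * ([forall m : 'I_n, ~~ pred0 (V m v)]
    && (V n v == Some x) && (V (n + j)%N v == Some y))%:R).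
  by apply: eq_bigr => v _; rewrite all_n -natrM mulnb.
by rewrite h; congr (_ * _); apply: eq_bigr => v _; rewrite all_n.
Qed.

(** These are the pairs of visits with [x] no later than [y]. By the Markov property the later
    visits contribute at most [gr x y] per visit to [x], and those visits at most [ga x]. *)
Lemma visits_pair_half x y :
  \sum_v q v * (\sum_(m < L) \sum_(j < L - m)
     (V m v == Some x)%:R * (V (m + j)%N v == Some y)%:R) <= ga x * gr x y.
Proof.
under eq_bigr do rewrite mulr_sumr.
rewrite exchange_big /=.
apply: (@le_trans _ _ (\sum_(m < L) ka m x * gr x y)); last first.
  by rewrite -mulr_suml ler_wpM2r ?gr_ge0.
apply: ler_sum => m _.
under eq_bigr do rewrite mulr_sumr.
rewrite exchange_big /=.
apply: (@le_trans _ _ (ka m x * \sum_(j < L - m) ks j x y)); last by rewrite ler_wpM2l.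
rewrite mulr_sumr; apply: ler_sum => j _; rewrite trace2 //.
by have := ltn_ord j; have := ltn_ord m; lia.
Qed.

Lemma visits_pair x y :
  \sum_v q v * (visits v x * visits v y) <= ga x * gr x y + ga y * gr y x.
Proof.
apply: le_trans (lerD (visits_pair_half x y) (visits_pair_half y x)).
rewrite -big_split /=; apply: ler_sum => v _; rewrite -mulrDr ler_wpM2l //.
exact: (@sum_mul_le_ordered _ (fun n => (V n v == Some x)%:R)
                              (fun n => (V n v == Some y)%:R)).
Qed.

Lemma opens_setU (s s' : {set C}) o : opens (s :|: s') o = opens s o && opens s' o.
Proof.
apply/forall_inP/andP => [h|[/forall_inP h1 /forall_inP h2] c].
  by split; apply/forall_inP => c cs; apply: h; rewrite inE cs ?orbT.
by rewrite inE => /orP[/h1|/h2].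
Qed.

(** An equality unless [ga x = 0], in which case the left side vanishes. *)
Lemma wt_ga (mu : S -> R) x : 0 <= mu x -> wt mu x * ga x <= mu x * p ^- #|anc x|.
Proof.
move=> mu0; rewrite /wt mulrAC ler_wpM2r ?powV_ge0 //.
by have [->|ga0] := eqVneq (ga x) 0; [rewrite mulr0 | rewrite divfK].
Qed.

(** Both points are open with probability [p ^+ #|anc x :|: anc y|]; inclusion-exclusion for
    cardinals turns this and the two weights into [p ^- #|anc x :&: anc y|]. Each of the two orders
    of visits contributes at most one energy. *)
Lemma hitmass_sqr (mu : S -> R) : (forall x, 0 <= mu x) ->
  jointE (fun v o => hitmass mu v o ^+ 2) <= 2 * energy mu.
Proof.
move=> mu0.
have -> : jointE (fun v o => hitmass mu v o ^+ 2) =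
    \sum_x \sum_y wt mu x * wt mu y * p ^+ #|anc x :|: anc y|
      * \sum_v q v * (visits v x * visits v y).
  transitivity (\sum_x \sum_y jointE (fun v o => wt mu x * wt mu y
      * (visits v x * visits v y * (opens (anc x :|: anc y) o)%:R))).
    under eq_bigr do rewrite -jointE_sum.
    rewrite -jointE_sum; apply: eq_jointE => v o.
    rewrite expr2 /hitmass mulr_suml; apply: eq_bigr => x _.
    rewrite mulr_sumr; apply: eq_bigr => y _.
    by rewrite opens_setU -mulnb natrM; ring.
  apply: eq_bigr => x _; apply: eq_bigr => y _.
  rewrite jointEZ -[RHS]mulrA; congr (_ * _).
  rewrite /jointE mulr_sumr; apply: eq_bigr => v _.
  by rewrite EbernZ Ebern_opens; ring.
pose e x y := gr x y / ga y * p ^- #|anc x :&: anc y| * mu x * mu y.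
apply: (@le_trans _ _ (\sum_x \sum_y (e x y + e y x))); last first.
  under eq_bigr do rewrite big_split.
  rewrite big_split /= [X in _ + X]exchange_big /= /energy -/e; lra.
have half x y : wt mu x * wt mu y * p ^+ #|anc x :|: anc y| * (ga x * gr x y) <= e x y.
  rewrite /e; have card := cardsUI (anc x) (anc y).
  have -> : p ^- #|anc x :&: anc y| =
      p ^- #|anc x| * p ^- #|anc y| * p ^+ #|anc x :|: anc y|.
    apply: (mulIf (expf_neq0 #|anc x :&: anc y| (lt0r_neq0 p_gt0))).
    rewrite mulVf ?expf_neq0 ?lt0r_neq0 // -!mulrA -exprD card exprD.
    by field; rewrite !expf_neq0 ?lt0r_neq0.
  rewrite [leLHS](_ : _ = (wt mu x * ga x) *
    (wt mu y * p ^+ #|anc x :|: anc y| * gr x y)); last by ring.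
  apply: le_trans (ler_wpM2r _ (wt_ga (mu0 x))) _.
    by rewrite mulr_ge0 ?gr_ge0 // mulr_ge0 ?pow_ge0 ?wt_ge0.
  by rewrite le_eqVlt /wt; apply/orP; left; apply/eqP; ring.
apply: ler_sum => x _; apply: ler_sum => y _.
apply: (@le_trans _ _ (wt mu x * wt mu y * p ^+ #|anc x :|: anc y| *
   (ga x * gr x y + ga y * gr y x))).
  by rewrite ler_wpM2l ?visits_pair // mulr_ge0 ?pow_ge0 // mulr_ge0 ?wt_ge0.
rewrite mulrDr lerD //; apply: le_trans (half y x).
by rewrite [wt mu x * _]mulrC finset.setUC.
Qed.

(** The factor [p ^- #|anc y|] in the weight cancels the probability that [y] is open. *)
Lemma hitmass_mean mu :
  jointE (hitmass mu) = \sum_y mu y / ga y * \sum_(n < L) ka n y.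
Proof.
rewrite /hitmass jointE_sum; apply: eq_bigr => y _.
rewrite -visits_mean /jointE mulr_sumr; apply: eq_bigr => v _.
rewrite EbernZ Ebern_opens /wt; move: (ga y)^-1 => g.
by field; rewrite expf_neq0 // lt0r_neq0.
Qed.

Lemma hitmass_hit mu v o : ~~ hit L v o -> hitmass mu v o = 0.
Proof.
move=> /existsPn nohit; rewrite /hitmass big1 // => y _.
rewrite /visits mulr_sumr mulr_suml big1 // => n _.
have := nohit n; case: eqP => [->|_] /=; last by rewrite mulr0 mul0r.
by move=> /negbTE ->; rewrite mulr0.
Qed.

(** On the event of a hit, [2 t Z <= 1 + t^2 Z^2]; off it, [Z = 0]. The free parameter [t] replaces
    the quotient in the Cauchy-Schwarz inequality, so no division by the energy occurs. *)
Lemma hit_lower (mu : S -> R) t : (forall x, 0 <= mu x) ->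
  2 * t * (\sum_y mu y / ga y * \sum_(n < L) ka n y) <=
  jointE (fun v o => (hit L v o)%:R) + 2 * t ^+ 2 * energy mu.
Proof.
move=> mu0; rewrite -hitmass_mean -jointEZ.
apply: (@le_trans _ _ (jointE (fun v o => (hit L v o)%:R + t ^+ 2 * hitmass mu v o ^+ 2))).
  apply: le_jointE => v o; case: (boolP (hit L v o)) => [_|/hitmass_hit ->] /=.
    rewrite -mulrA -exprMn; move: (t * _) => z.
    have := sqr_ge0 (z - 1); rewrite sqrrB1 mulr1n; lra.
  by rewrite expr0n /= !mulr0 addr0.
rewrite jointED jointEZ lerD2l (mulrC 2) -[leRHS]mulrA ler_wpM2l ?sqr_ge0 //.
exact: hitmass_sqr.
Qed.

(** * The first open point and the visits after it *)

Lemma hitS n v o : hit n.+1 v o = hit n v o || isopen (V n v) o.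
Proof.
apply/existsP/orP => [[m hm]|[/existsP[m hm]|hn]].
- have := ltn_ord m; rewrite ltnS leq_eqVlt => /orP[/eqP mn|mn].
    by right; rewrite -mn.
  by left; apply/existsP; exists (Ordinal mn).
- by exists (widen_ord (leqnSn n) m).
- by exists ord_max.
Qed.

Lemma sum_firsthit N v o : \sum_x firsthit N x v o = (hit N v o)%:R.
Proof.
rewrite /firsthit exchange_big /=; elim: N => [|N IH].
  by rewrite big_ord0; case: (boolP (hit 0 v o)) => // /existsP[[]].
rewrite big_ord_recr /= IH hitS; case: (boolP (hit N v o)) => _ /=.
  by rewrite big1 ?addr0.
rewrite add0r; case: (V N v) => [z|] /=; last first.
  by rewrite big1 // => x _; case: eqP.
rewrite (bigD1 z) //= eqxx big1 ?addr0 // => x xz.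
by case: eqP => // -[zx]; rewrite zx eqxx in xz.
Qed.

Lemma firsthit_ge0 N x v o : 0 <= firsthit N x v o.
Proof. by apply: sumr_ge0 => n _; rewrite ler0n. Qed.

Lemma firsthit_opens N x v o :
  firsthit N x v o * (opens (anc x) o)%:R = firsthit N x v o.
Proof.
rewrite /firsthit mulr_suml; apply: eq_bigr => n _.
by rewrite -natrM mulnb -andbA andbb.
Qed.

Definition hitlaw (N : nat) (x : S) : R := jointE (firsthit N x).

Lemma hitlaw_ge0 N x : 0 <= hitlaw N x.
Proof. by apply: jointE_ge0 => v o; exact: firsthit_ge0. Qed.

Lemma sum_hitlaw N : \sum_x hitlaw N x = jointE (fun v o => (hit N v o)%:R).
Proof.
by rewrite /hitlaw -jointE_sum; apply: eq_jointE => v o; rewrite sum_firsthit.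
Qed.

Lemma firsthit_le_visits N x v o : (N <= L)%N -> firsthit N x v o <= visits v x.
Proof.
move=> NL; rewrite /firsthit /visits (big_ord_widen _ (fun n =>
  (~~ hit n v o && (V n v == Some x) && opens (anc x) o)%:R : R) NL).
rewrite big_mkcond /=; apply: ler_sum => n _.
by case: ifP => _; case: eqP; rewrite /= ?andbF ?ler0n // lern1 leq_b1.
Qed.

(** A first hit is a visit. Hence the hitting law vanishes where [ga] does, which later keeps its
    energy free of infinite terms. *)
Lemma hitlaw_le N x : (N <= L)%N -> hitlaw N x <= ga x.
Proof.
move=> NL; apply: (le_trans _ (ka_le L x)); rewrite -visits_mean.
apply: ler_sum => v _; rewrite ler_wpM2l //.
rewrite -[leRHS]mulr1 -(Ebern1 C p) -EbernZ; apply: le_Ebern => // o.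
by rewrite mulr1 firsthit_le_visits.
Qed.

(* The strong Markov property at the first hitting time, for each fixed
   configuration of the percolation. *)
Lemma firsthit_visits N M x y : (N + M <= L)%N ->
  hitlaw N x * (\sum_(j < M) ks j x y) <=
  jointE (fun v o => firsthit N x v o * visits v y).
Proof.
move=> NML.
pose b n v o := ~~ hit n v o && (V n v == Some x) && opens (anc x) o.
pose B n o := \sum_v q v * ([forall m : 'I_n, ~~ isopen (V m v) o]
                            && (V n v == Some x))%:R.
have hitE n v o : ~~ hit n v o = [forall m : 'I_n, ~~ isopen (V m v) o].
  by rewrite negb_exists.
have -> : hitlaw N x = \sum_o bern p o * \sum_(n < N) (opens (anc x) o)%:R * B n o.
  rewrite /hitlaw /jointE /Ebern.
  under eq_bigr do rewrite mulr_sumr.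
  rewrite exchange_big /=; apply: eq_bigr => o _.
  transitivity (bern p o * \sum_v q v * firsthit N x v o).
    by rewrite mulr_sumr; apply: eq_bigr => v _; rewrite mulrCA.
  congr (_ * _); rewrite /firsthit.
  under eq_bigr do rewrite mulr_sumr.
  rewrite exchange_big /=; apply: eq_bigr => n _.
  rewrite /B mulr_sumr; apply: eq_bigr => v _.
  by rewrite hitE -mulnb natrM; ring.
have -> : jointE (fun v o => firsthit N x v o * visits v y) =
    \sum_o bern p o * \sum_(n < N) \sum_v q v * ((b n v o)%:R * visits v y).
  rewrite /jointE /Ebern.
  under eq_bigr do rewrite mulr_sumr.
  rewrite exchange_big /=; apply: eq_bigr => o _.
  transitivity (bern p o * \sum_v q v * (firsthit N x v o * visits v y)).
    by rewrite mulr_sumr; apply: eq_bigr => v _; rewrite mulrCA.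
  congr (_ * _); rewrite exchange_big /=; apply: eq_bigr => v _.
  by rewrite /firsthit mulr_suml mulr_sumr.
rewrite mulr_suml; apply: ler_sum => o _.
rewrite -mulrA ler_wpM2l ?bern_ge0 // mulr_suml; apply: ler_sum => n _.
have -> : (opens (anc x) o)%:R * B n o * (\sum_(j < M) ks j x y) =
  \sum_v q v * \sum_(j < M) (b n v o && (V (n + j)%N v == Some y))%:R.
  rewrite -mulrA mulr_sumr.
  transitivity ((opens (anc x) o)%:R * \sum_(j < M) \sum_v q v *
     ([forall m : 'I_n, ~~ isopen (V m v) o] && (V n v == Some x)
                && (V (n + j)%N v == Some y))%:R).
    congr (_ * _); apply: eq_bigr => j _.
    (* For fixed [o], not having hit before time [n] means avoiding the open target points. *)
    rewrite (trace_markov x y (fun s => isopen s o)) //.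
    by have := ltn_ord j; have := ltn_ord n; lia.
  rewrite exchange_big /= mulr_sumr; apply: eq_bigr => v _.
  rewrite !mulr_sumr; apply: eq_bigr => j _.
  rewrite /b hitE mulrCA -natrM mulnb [X in nat_of_bool X]andbC -!andbA.
  by rewrite [opens _ _ && _]andbC.
apply: ler_sum => v _; rewrite ler_wpM2l //.
(* Of all visits to [y], only those at times [n] to [n + M - 1] are kept; they lie below the horizon
   [L]. *)
have NL : (n + M <= L)%N by have := ltn_ord n; lia.
rewrite /visits.
under eq_bigr do rewrite -mulnb natrM.
rewrite -mulr_sumr ler_wpM2l ?ler0n //.
exact: (@sum_shift_le _ (fun k => (V k v == Some y)%:R)).
Qed.

(** * Revealing the cubes along an order *)

Section Sweep.
Variable le : rel S.
Hypotheses (le_total : total le) (le_trans : transitive le).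
(** The points of each cube form an interval for [le]. *)
Hypothesis le_convex : forall x y z,
  le z x -> le x y -> anc z :&: anc y \subset anc x.

Definition swept (x : S) : {set C} := \bigcup_(z | le z x) anc z.

Definition sweep (N : nat) (v : OX) (o : cfg) : R :=
  \sum_x condE p (swept x) (firsthit N x v) o.

Lemma sweep_refl x : le x x.
Proof. by have := le_total x x; rewrite orbb. Qed.

Lemma swept_mono x y : le x y -> swept x \subset swept y.
Proof.
move=> xy; apply/finset.bigcupsP => z zx; apply: (finset.bigcup_max z) => //.
exact: le_trans xy.
Qed.

(** A cube of [y] that also contains some [z] below [x] must contain [x] by convexity. So the sweep
    up to [x] reveals no cube of [y] beyond those shared with [x]. *)
Lemma swept_anc x y : le x y -> anc y :&: swept x = anc x :&: anc y.
Proof.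
move=> xy; apply/finset.setP => c; rewrite !inE andbC; apply/andP/andP.
  case=> /finset.bigcupP[z zx cz] cy; split=> //.
  by have /fintype.subsetP := le_convex zx xy; apply; rewrite inE cz.
by case=> cx cy; split=> //; apply/finset.bigcupP; exists x; rewrite ?sweep_refl.
Qed.

(* Dual form of Doob's inequality: for x <= y, condE of the y-sweep fixes the
   x-term by the tower property, so each cross term loses one condE. *)
Lemma sweep_sqr N : jointE (fun v o => sweep N v o ^+ 2) <=
  4 * jointE (fun v o => (hit N v o)%:R).
Proof.
have f0 N' x v o := firsthit_ge0 N' x v o.
have c0 N' x v o : 0 <= condE p (swept x) (firsthit N' x v) o.
  by apply: condE_ge0.
have sqr_le : jointE (fun v o => sweep N v o ^+ 2) <=
    2 * jointE (fun v o => (hit N v o)%:R * sweep N v o).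
  rewrite -jointEZ; apply: ler_sum => v _; rewrite ler_wpM2l //.
  pose T x y := Ebern p (fun o => condE p (swept x) (firsthit N x v) o
                                 * condE p (swept y) (firsthit N y v) o).
  have T0 x y : 0 <= T x y by apply: Ebern_ge0 => // o; rewrite mulr_ge0.
  have -> : Ebern p (fun o => sweep N v o ^+ 2) = \sum_x \sum_y T x y.
    rewrite /T; under eq_bigr do rewrite -Ebern_sum.
    rewrite -Ebern_sum; apply: eq_Ebern => o; rewrite expr2 /sweep mulr_suml.
    by apply: eq_bigr => x _; rewrite mulr_sumr.
  pose T' x y := Ebern p (fun o => condE p (swept x) (firsthit N x v) o * firsthit N y v o).
  have T'0 x y : 0 <= T' x y by apply: Ebern_ge0 => // o; rewrite mulr_ge0.
  have TT' x y : le x y -> T x y = T' x y.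
    move=> xy; rewrite /T condE_adj /T'; apply: eq_Ebern => o.
    by rewrite condE_tower // swept_mono.
  apply: (@Order.POrderTheory.le_trans _ _ (\sum_x \sum_y (T' x y + T' y x))).
    apply: ler_sum => x _; apply: ler_sum => y _.
    have [/TT' ->|/TT' h] := orP (le_total x y); first by rewrite lerDl.
    by rewrite /T; under eq_Ebern do rewrite mulrC; rewrite -/(T y x) h lerDr.
  under eq_bigr do rewrite big_split.
  rewrite big_split /= [X in _ + X]exchange_big /=.
  rewrite EbernZ; set a := (\sum_x _); rewrite -[X in X <= _]/(a + a).
  suff -> : a = Ebern p (fun o => (hit N v o)%:R * sweep N v o) by lra.
  rewrite /a /T'; under eq_bigr do rewrite -Ebern_sum.
  rewrite -Ebern_sum; apply: eq_Ebern => o.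
  rewrite -sum_firsthit mulrC /sweep mulr_suml.
  by apply: eq_bigr => x _; rewrite mulr_sumr.
(* On a hit, [2 s <= 2 + s^2 / 2]. Half of the second moment is then absorbed by the left side,
   which gives the constant 4. *)
suff : 2 * jointE (fun v o => (hit N v o)%:R * sweep N v o) <=
    2 * jointE (fun v o => (hit N v o)%:R) + 2^-1 * jointE (fun v o => sweep N v o ^+ 2).
  by lra.
rewrite -!jointEZ -jointED; apply: le_jointE => v o.
case: (hit N v o) => /=; move: (sweep N v o) => s.
  by have := sqr_ge0 (s - 2); rewrite sqrrB; lra.
by have := sqr_ge0 s; rewrite !mulr0 mul0r; lra.
Qed.

(** By adjointness the conditioning moves to the event that [y] is open. For [x <= y] the revealed
    cubes of [y] are shared with [x], hence open at a first hit in [x]; the others cost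
    [p ^+ #|anc y :\: anc x|]. The visits to [y] after the hit give the sum of [ks], and the
    remaining pairs are dropped as nonnegative. *)
Lemma sweep_hitmass N M (mu : S -> R) : (N + M <= L)%N -> (forall x, 0 <= mu x) ->
  \sum_x \sum_(y | le x y)
    (\sum_(j < M) ks j x y) / ga y * p ^- #|anc x :&: anc y| * hitlaw N x * mu y
  <= jointE (fun v o => hitmass mu v o * sweep N v o).
Proof.
move=> NML mu0.
have f0 x v o := firsthit_ge0 N x v o.
have -> : jointE (fun v o => hitmass mu v o * sweep N v o) =
    \sum_x \sum_y wt mu y * jointE (fun v o => visits v y
      * (condE p (swept x) (fun o => (opens (anc y) o)%:R) o * firsthit N x v o)).
  under [RHS]eq_bigr do (under eq_bigr do rewrite -jointEZ; rewrite -jointE_sum).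
  rewrite -jointE_sum; apply: eq_bigr => v _; congr (_ * _).
  rewrite Ebern_sum.
  transitivity (\sum_x Ebern p (fun o => hitmass mu v o * condE p (swept x) (firsthit N x v) o)).
    by rewrite -Ebern_sum; apply: eq_Ebern => o; rewrite /sweep mulr_sumr.
  apply: eq_bigr => x _; rewrite Ebern_sum.
  transitivity (\sum_y Ebern p (fun o => wt mu y * (visits v y *
     ((opens (anc y) o)%:R * condE p (swept x) (firsthit N x v) o)))).
    rewrite -Ebern_sum; apply: eq_Ebern => o; rewrite /hitmass mulr_suml.
    by apply: eq_bigr => y _; rewrite -!mulrA.
  by apply: eq_bigr => y _; rewrite !EbernZ condE_adj.
apply: ler_sum => x _; rewrite big_mkcond /=; apply: ler_sum => y _.
case: ifP => [xy|_]; last first.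
  rewrite mulr_ge0 ?wt_ge0 // jointE_ge0 // => v o.
  rewrite mulr_ge0 ?visits_ge0 // mulr_ge0 //; exact: condE_ge0.
have -> : jointE (fun v o => visits v y
      * (condE p (swept x) (fun o => (opens (anc y) o)%:R) o * firsthit N x v o)) =
    p ^+ #|anc y :\: anc x| * jointE (fun v o => firsthit N x v o * visits v y).
  rewrite -jointEZ; apply: eq_jointE => v o.
  rewrite condE_opens swept_anc // -{1}firsthit_opens.
  have -> : #|anc y :\: swept x| = #|anc y :\: anc x|.
    have := cardsID (swept x) (anc y); have := cardsID (anc x) (anc y).
    by rewrite swept_anc // finset.setIC; lia.
  have : (opens (anc x :&: anc y) o)%:R * (opens (anc x) o)%:R = (opens (anc x) o)%:R :> R.
    rewrite -natrM mulnb andb_idl // => /forall_inP h; apply/forall_inP => c.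
    by rewrite inE => /andP[/h].
  move=> e; transitivity (p ^+ #|anc y :\: anc x| * visits v y * (firsthit N x v o *
      ((opens (anc x :&: anc y) o)%:R * (opens (anc x) o)%:R))); first by ring.
  by rewrite e firsthit_opens; ring.
have -> : p ^- #|anc x :&: anc y| = p ^- #|anc y| * p ^+ #|anc y :\: anc x|.
  rewrite -(cardsID (anc x) (anc y)) exprD (finset.setIC (anc y)).
  by field; rewrite !expf_neq0 ?lt0r_neq0.
rewrite [leLHS](_ : _ = (wt mu y * p ^+ #|anc y :\: anc x|) *
   (hitlaw N x * \sum_(j < M) ks j x y)); last by rewrite /wt; ring.
rewrite [leRHS]mulrA ler_wpM2l ?firsthit_visits // mulr_ge0 ?pow_ge0 // wt_ge0 //.
Qed.

End Sweep.

Lemma hit_upper (le : rel S) N M : total le -> transitive le ->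
  (forall x y z, le z x -> le x y -> anc z :&: anc y \subset anc x) ->
  (N + M <= L)%N ->
  (forall x y, gr x y <= 2 * \sum_(j < M) ks j x y) ->
  energy (hitlaw N) <= 128 * jointE (fun v o => (hit N v o)%:R).
Proof.
move=> tot tr conv NML grM.
pose ge : rel S := fun x y => le y x.
have tot' : total ge by move=> x y; rewrite /ge tot.
have tr' : transitive ge by move=> x y z xy yz; apply: tr xy.
have conv' x y z : ge z x -> ge x y -> anc z :&: anc y \subset anc x.
  by move=> xz yx; rewrite finset.setIC; apply: conv.
have nu0 := hitlaw_ge0 N.
have b1 := sweep_hitmass tot conv NML nu0.
have b2 := sweep_hitmass tot' conv' NML nu0.
have s1 := sweep_sqr tot tr N; have s2 := sweep_sqr tot' tr' N.
have z2 := hitmass_sqr nu0.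
set nu := hitlaw N in b1 b2 z2 nu0 *.
set H := jointE (fun v o => (hit N v o)%:R) in s1 s2 *.
pose e x y := (\sum_(j < M) ks j x y) / ga y * p ^- #|anc x :&: anc y| * nu x * nu y.
have e0 x y : 0 <= e x y.
  by rewrite /e !mulr_ge0 ?powV_ge0 ?invr_ge0 ?ga_ge0 // sumr_ge0.
(* The factor 2 comes from truncating [gr]; by totality every pair occurs in at least one of the two
   sums. *)
have en : energy nu <= 2 * (\sum_x \sum_(y | le x y) e x y + \sum_x \sum_(y | ge x y) e x y).
  rewrite /energy -big_split mulr_sumr; apply: ler_sum => x _ /=.
  rewrite (big_mkcond (le x)) (big_mkcond (ge x)) -big_split mulr_sumr; apply: ler_sum => y _ /=.
  apply: (@Order.POrderTheory.le_trans _ _ (2 * e x y)).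
    rewrite /e !mulrA; do 4?rewrite ler_wpM2r ?powV_ge0 ?invr_ge0 ?ga_ge0 //.
  rewrite ler_wpM2l //; have := tot x y; rewrite /ge; have := e0 x y.
  by case: (le x y) (le y x) => [] [] //=; lra.
(* The weight [1/16] is chosen so that half of the energy can be absorbed: each order contributes at
   most [energy / 8 + 16 H], so [energy <= 2 (energy / 4 + 32 H)], that is [energy <= 128 H]. *)
have cs F : jointE (fun v o => hitmass nu v o * F v o) <=
    16^-1 * jointE (fun v o => hitmass nu v o ^+ 2) + 4 * jointE (fun v o => F v o ^+ 2).
  rewrite -!jointEZ -jointED; apply: le_jointE => v o.
  move: (hitmass nu v o) (F v o) => z f.
  by have := sqr_ge0 (z / 4 - 2 * f); rewrite sqrrB; nra.
have := cs (sweep le N); have := cs (sweep ge N).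
rewrite -/(e _ _) in b1 b2; move: b1 b2 en; rewrite -/e; lra.
Qed.

End Hitting.

(** * Countably-valued maps on a probability space *)

Lemma esumZl (R : realType) (I : choiceType) (S : set I) (k : R) (f : I -> \bar R) :
  0 <= k -> (forall i, (0 <= f i)%E) ->
  (\esum_(i in S) (k%:E * f i) = k%:E * \esum_(i in S) f i)%E.
Proof.
move=> k0 f0; rewrite /esum -ereal_supZl //; last first.
  by apply/set0P; exists (\sum_(x \in set0) f x)%E, set0 => //; exact: fsets_set0.
congr ereal_sup; rewrite image_comp; apply: eq_imagel => A [finA AS] /=.
by rewrite ge0_mule_fsumr.
Qed.

Section CountableValued.
Context (R : realType) (dT : measure_display) (T : measurableType dT).
Variable (P : probability T R).

(** For a countable codomain, measurable fibres make every preimage measurable, so [I] needs no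
    sigma-algebra. *)
Definition cmeas (I : Type) (f : T -> I) := forall i, measurable [set w | f w = i].

Lemma cmeas_preimage (I : countType) (f : T -> I) (B : set I) :
  cmeas f -> measurable [set w | B (f w)].
Proof.
move=> mf; rewrite (_ : [set _ | _] = \bigcup_i (if pselect (B i) then [set w | f w = i] else set0)).
  apply: countable_bigcupT_measurable => [|i]; first exact: countableP.
  by case: pselect => ?; [exact: mf | exact: measurable0].
apply/seteqP; split => w /=.
  by move=> Bw; exists (f w) => //; case: pselect.
by case=> i _; case: pselect => //= Bi ->.
Qed.

Lemma cmeas_comp (I : countType) (J : Type) (f : T -> I) (g : I -> J) :
  cmeas f -> cmeas (g \o f).
Proof. by move=> mf j; exact: (cmeas_preimage [set i | g i = j]). Qed.

Lemma measure_countable_partition (I : countType) (f : T -> I) (B : set I) (E : set T) :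
  cmeas f -> measurable E ->
  P ([set w | B (f w)] `&` E) = (\esum_(i in B) P ([set w | f w = i] `&` E))%E.
Proof.
move=> mf mE.
pose F n := [set w | pickle (f w) = n] `&` E.
have Fp i : F (pickle i) = [set w | f w = i] `&` E.
  apply/seteqP; split=> w [/= h Ew]; split=> //=; last by rewrite h.
  exact: pcan_inj pickleK _ _ h.
have -> : [set w | B (f w)] `&` E = \bigcup_(n in pickle @` B) F n.
  apply/seteqP; split=> w /=.
    by move=> [Bw Ew]; exists (pickle (f w)) => //; exists (f w).
  by case=> _ [i Bi <-]; rewrite Fp => -[/= -> Ew].
rewrite measure_bigcup.
- rewrite nneseries_esum //.
  rewrite (_ : [set x | _] = pickle @` B); last first.
    by apply/seteqP; split=> n /=; rewrite inE.
  rewrite esum_image; first by apply: eq_esum => i _; rewrite Fp.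
  by move=> i j _ _; exact: (pcan_inj pickleK).
- by move=> _ [i Bi <-]; rewrite Fp; apply: measurableI.
- by move=> n m _ _ [w [[/= <- _] [/= <- _]]].
Qed.

(** Proportionality with one constant on every fibre adds up over fibres; this carries identities
    from cylinders to general events of the trace. *)
Lemma measure_partition_proportional (I : countType) (f : T -> I) (B : set I)
    (E E' : set T) (k : R) : 0 <= k ->
  cmeas f -> measurable E -> measurable E' ->
  (forall i, B i -> (P ([set w | f w = i] `&` E) = k%:E * P ([set w | f w = i] `&` E'))%E) ->
  (P ([set w | B (f w)] `&` E) = k%:E * P ([set w | B (f w)] `&` E'))%E.
Proof.
move=> k0 mf mE mE' h; rewrite !measure_countable_partition // -esumZl //.
by apply: eq_esum.
Qed.

Lemma measure_finite_preimage (I : finType) (f : T -> I) (B : pred I) : cmeas f ->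
  fine (P [set w | B (f w)]) = \sum_i fine (P [set w | f w = i]) * (B i)%:R.
Proof.
move=> mf.
have seqE (s : seq I) : uniq s ->
    fine (P [set w | f w \in s]) = \sum_(i <- s) fine (P [set w | f w = i]).
  elim: s => [_|i s IH /= /andP[nis us]].
    by rewrite big_nil (_ : [set _ | _] = set0) ?measure0 //; apply/seteqP; split.
  rewrite big_cons -IH // -fineD ?fin_num_measure //; last first.
    exact: (cmeas_preimage [set j | j \in s]).
  rewrite -measureU //; last 2 first.
  - exact: (cmeas_preimage [set j | j \in s]).
  - by apply/seteqP; split=> w //= [-> si]; rewrite si in nis.
  congr (fine (P _)); apply/seteqP; split=> w /=.
    by rewrite inE => /orP[/eqP|]; [left|right].
  by case=> [->|h]; rewrite inE ?eqxx // h orbT.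
transitivity (fine (P [set w | f w \in enum B])).
  by congr (fine (P _)); apply/seteqP; split=> w /=; rewrite mem_enum.
rewrite seqE ?enum_uniq // big_enum /= big_mkcond; apply: eq_bigr => i _ /=.
by rewrite -[i \in B]/(B i); case: (B i); rewrite ?mulr1 ?mulr0.
Qed.

Lemma cmeas_pair (I J : countType) (f : T -> I) (g : T -> J) :
  cmeas f -> cmeas g -> cmeas (fun w => (f w, g w)).
Proof.
move=> mf mg [i j]; rewrite (_ : [set _ | _] = [set w | f w = i] `&` [set w | g w = j]).
  exact: measurableI.
by apply/seteqP; split=> w /= [-> ->].
Qed.

(* Inclusion-exclusion on the closed coordinates, one at a time. *)
Lemma bernoulli_field (C : finType) (p : R) (ev : C -> T -> bool) (A : set T) :
  measurable A -> (forall c, measurable [set w | ev c w]) ->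
  (forall s : seq C, uniq s ->
     P (A `&` [set w | forall c, c \in s -> ev c w]) = (P A * (p ^+ size s)%:E)%E) ->
  forall o : {ffun C -> bool},
  P (A `&` [set w | [ffun c => ev c w] = o]) = (P A * (bern p o)%:E)%E.
Proof.
move=> mA mev h o.
pose op (s : seq C) := [set w | forall c, c \in s -> ev c w].
pose ag (s : seq C) := [set w | forall c, c \in s -> ev c w = o c].
have mop s : measurable (op s).
  elim: s => [|c s IH]; first by rewrite (_ : op _ = setT) //; apply/seteqP; split.
  rewrite (_ : op _ = [set w | ev c w] `&` op s); first exact: measurableI.
  apply/seteqP; split=> w /=.
    by move=> hw; split=> [|c' cs]; apply: hw; rewrite inE ?eqxx ?cs ?orbT.
  by move=> [hc hs] c'; rewrite inE => /orP[/eqP ->//|/hs].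
have agS c s : ag (c :: s) = [set w | ev c w = o c] `&` ag s.
  apply/seteqP; split=> w /=.
    by move=> hw; split=> [|c' cs]; apply: hw; rewrite inE ?eqxx ?cs ?orbT.
  by move=> [hc hs] c'; rewrite inE => /orP[/eqP ->//|/hs].
have mag s : measurable (ag s).
  elim: s => [|c s IH]; first by rewrite (_ : ag _ = setT) //; apply/seteqP; split.
  rewrite agS; apply: measurableI => //; case: (o c); first exact: mev.
  rewrite (_ : [set _ | _] = ~` [set w | ev c w]); first exact: measurableC.
  by apply/seteqP; split=> w /=; [move=> -> | move/negP/negbTE].
(* [s1] lists coordinates required to be open, [s2] those with a prescribed state. A closed
   coordinate of [s2] is handled by subtracting from the unconstrained event the one where it is
   open, that is, moved to [s1]. *)
have key s2 s1 : uniq (s1 ++ s2) ->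
    P (A `&` op s1 `&` ag s2) =
    (P A * (p ^+ size s1 * \prod_(c <- s2) (if o c then p else 1 - p))%:E)%E.
  elim: s2 s1 => [|c s2 IH] s1.
    rewrite cats0 big_nil mulr1 => /h <-; congr (P _).
    by apply/seteqP; split=> w /=; [case | split].
  rewrite -cat_rcons => us; have := IH _ us; rewrite size_rcons.
  have opr : op (rcons s1 c) = op s1 `&` [set w | ev c w].
    apply/seteqP; split=> w /=.
      by move=> hw; split=> [c' cs|]; apply: hw; rewrite mem_rcons inE ?eqxx ?cs ?orbT.
    by move=> [hs hc] c'; rewrite mem_rcons inE => /orP[/eqP ->//|/hs].
  have us' : uniq (s1 ++ s2).
    by move: us; rewrite -cats1 -catA !cat_uniq /= => /and3P[-> /norP[_ ->] /andP[_ ->]].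
  have := IH _ us'; rewrite agS big_cons opr.
  set G := A `&` op s1 `&` ag s2.
  have mG : measurable G by do 2 apply: measurableI => //.
  have -> : A `&` (op s1 `&` [set w | ev c w]) `&` ag s2 = G `&` [set w | ev c w].
    by rewrite /G !setIA -!(setIAC _ (ag s2)).
  have -> : A `&` op s1 `&` ([set w | ev c w = o c] `&` ag s2) = G `&` [set w | ev c w = o c].
    by rewrite /G setIA setIAC.
  have [x Ax] : exists x, P A = x%:E by exists (fine (P A)); rewrite fineK ?fin_num_measure.
  case: (o c) => [_ ->|eG eGc]; first by rewrite exprS; congr (_ * _%:E)%E; ring.
  have -> : G `&` [set w | ev c w = false] = G `\` [set w | ev c w].
    by apply/seteqP; split=> w /=; [move=> [? ->] | move=> [? /negP/negbTE]].
  transitivity (P G - P (G `&` [set w | ev c w]))%E.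
    by rewrite measureD // -ge0_fin_numE ?fin_num_measure.
  by rewrite eG eGc Ax -!EFinM -EFinB exprS; congr _%:E; ring.
have := key (enum C) [::] (enum_uniq _).
rewrite expr0 mul1r big_enum /= => <-; congr (P _).
apply/seteqP; split=> w /= [Aw ow].
  by split=> // c _; rewrite -ow ffunE.
split; first by case: Aw.
by apply/ffunP => c; rewrite ffunE ow // mem_enum.
Qed.

End CountableValued.

(** * Green functions and the Markov property *)

Section Green.
Context (R : realType) (dim : nat) (K : Zd dim -> Zd dim -> R).
Hypothesis K_ge0 : forall x y, 0 <= K x y.
Hypothesis green_fin : forall x y, (green K x y < +oo)%E.

Lemma nstep_ge0 n x y : (0 <= nstep K n x y)%E.
Proof.
elim: n x y => [|n IH] x y /=; first by rewrite lee_fin ler0n.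
by apply: esum_ge0 => z _; rewrite mule_ge0 ?lee_fin.
Qed.

Lemma green_ge0 x y : (0 <= green K x y)%E.
Proof. by apply: esum_ge0 => n _; exact: nstep_ge0. Qed.

Lemma green_fin_num x y : green K x y \is a fin_num.
Proof. by rewrite ge0_fin_numE ?green_ge0. Qed.

Lemma green_series x y : green K x y = (\sum_(n <oo) nstep K n x y)%E.
Proof. by rewrite nneseries_esumT // => n; exact: nstep_ge0. Qed.

Lemma sum_nstep_le_green k x y : (\sum_(n < k) nstep K n x y <= green K x y)%E.
Proof.
rewrite green_series -(big_mkord xpredT (fun n => nstep K n x y)).
by apply: nneseries_lim_ge => n _ _; exact: nstep_ge0.
Qed.

Lemma nstep_fin_num n x y : nstep K n x y \is a fin_num.
Proof.
rewrite ge0_fin_numE ?nstep_ge0 //; apply: le_lt_trans (green_fin x y).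
apply: le_trans (sum_nstep_le_green n.+1 x y).
by rewrite big_ord_recr /= leeDr // sume_ge0 // => i _; exact: nstep_ge0.
Qed.

Definition stepr n x y : R := fine (nstep K n x y).
Definition greenr x y : R := fine (green K x y).

Lemma stepr_ge0 n x y : 0 <= stepr n x y.
Proof. by rewrite fine_ge0 ?nstep_ge0. Qed.

Lemma steprE n x y : nstep K n x y = (stepr n x y)%:E.
Proof. by rewrite fineK ?nstep_fin_num. Qed.

Lemma greenrE x y : green K x y = (greenr x y)%:E.
Proof. by rewrite fineK ?green_fin_num. Qed.

Lemma greenr_ge0 x y : 0 <= greenr x y.
Proof. by rewrite fine_ge0 ?green_ge0. Qed.

Lemma sum_stepr_le k x y : \sum_(n < k) stepr n x y <= greenr x y.
Proof.
rewrite -lee_fin -greenrE; apply: le_trans (sum_nstep_le_green k x y).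
by rewrite -sumEFin; under eq_bigr do rewrite -steprE.
Qed.

Lemma greenr_diag x : 1 <= greenr x x.
Proof.
apply: le_trans (sum_stepr_le 1 x x).
by rewrite big_ord1 /stepr /= eqxx.
Qed.

(** If all partial sums stayed below [(1 - e)] times the Green function, so would their limit, which
    is impossible when it is positive and finite. *)
Lemma sum_stepr_approx_pt (e : R) x y : 0 < e ->
  exists k, (1 - e) * greenr x y <= \sum_(n < k) stepr n x y.
Proof.
move=> e0; have [g0|g0] := eqVneq (greenr x y) 0.
  by exists 0%N; rewrite g0 mulr0 big_ord0.
have {}g0 : 0 < greenr x y by rewrite lt_neqAle eq_sym g0 greenr_ge0.
apply: contrapT => /forallNP no.
have : (green K x y <= ((1 - e) * greenr x y)%:E)%E.
  rewrite green_series; apply: lime_le.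
    by apply: is_cvg_nneseries => n _ _; exact: nstep_ge0.
  apply: nearW => k; rewrite big_mkord.
  under eq_bigr do rewrite steprE.
  by rewrite sumEFin lee_fin; move/negP: (no k); rewrite -ltNge => /ltW.
rewrite greenrE lee_fin; nra.
Qed.

Lemma sum_stepr_mono k k' x y : (k <= k')%N ->
  \sum_(n < k) stepr n x y <= \sum_(n < k') stepr n x y.
Proof.
move=> kk'; exact: (@sum_shift_le _ (fun n => stepr n x y) 0 k k' (fun n => stepr_ge0 n x y)).
Qed.

Lemma sum_stepr_approx (e : R) (s : seq (Zd dim)) : 0 < e ->
  exists k, forall x y, x \in s -> y \in s ->
    (1 - e) * greenr x y <= \sum_(n < k) stepr n x y.
Proof.
move=> e0.
have pairs (ps : seq (Zd dim * Zd dim)) : exists k, forall u, u \in ps ->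
    (1 - e) * greenr u.1 u.2 <= \sum_(n < k) stepr n u.1 u.2.
  elim: ps => [|[x y] ps [k IH]]; first by exists 0%N.
  have [k' hk'] := sum_stepr_approx_pt x y e0.
  exists (maxn k k') => u; rewrite inE => /orP[/eqP ->|/IH h].
    by apply: le_trans hk' _; rewrite sum_stepr_mono // leq_maxr.
  by apply: le_trans h _; rewrite sum_stepr_mono // leq_maxl.
have [k hk] := pairs [seq (x, y) | x <- s, y <- s].
exists k => x y xs ys; apply: (hk (x, y)).
by apply/allpairsP; exists (x, y).
Qed.

End Green.

Section Chain.
Context (R : realType) (dim : nat) (dT : measure_display) (T : measurableType dT).
Context (P : probability T R) (K : Zd dim -> Zd dim -> R) (X : nat -> T -> Zd dim).
Variable a : Zd dim.
Hypothesis K_ge0 : forall x y, 0 <= K x y.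
Hypothesis green_fin : forall x y, (green K x y < +oo)%E.
Hypothesis mX : forall n x, measurable [set w | X n w = x].

Definition cyl (xs : seq (Zd dim)) : set T :=
  [set w | forall i, (i < size xs)%N -> X i w = nth a xs i].

Hypothesis chainP : forall xs, P (cyl xs) = (pathprob K a xs)%:E.

Definition trace n w : seq (Zd dim) := mkseq (fun i => X i w) n.

Lemma cylE xs : cyl xs = [set w | trace (size xs) w = xs].
Proof.
apply/seteqP; split=> w /= h.
  by apply: (@eq_from_nth _ a); rewrite size_mkseq // => i ilt; rewrite nth_mkseq // h.
by move=> i ilt; rewrite -h nth_mkseq.
Qed.

Lemma cmeas_trace n : cmeas (trace n).
Proof.
elim: n => [|n IH] xs.
  rewrite (_ : [set w | _] = [set w | [::] = xs]) //.
  by case: (pselect ([::] = xs)) => h; [rewrite (_ : [set _ | _] = setT) //|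
    rewrite (_ : [set _ | _] = set0) //]; apply/seteqP; split.
have := cmeas_comp (fun u => rcons u.1 u.2) (cmeas_pair IH (mX n)).
move/(_ xs); congr (measurable _); apply/seteqP; split=> w /=;
  by rewrite /trace mkseqS.
Qed.

Lemma measurable_cyl xs : measurable (cyl xs).
Proof. by rewrite cylE; exact: cmeas_trace. Qed.

Lemma cyl_rcons s x : cyl (rcons s x) = cyl s `&` [set w | X (size s) w = x].
Proof.
apply/seteqP; split=> w /=.
  move=> h; split=> [i ilt|].
    by have := h i; rewrite size_rcons nth_rcons ilt => -> //; exact: ltnW.
  by have := h (size s); rewrite size_rcons nth_rcons ltnn eqxx => ->.
move=> [h hx] i; rewrite size_rcons ltnS leq_eqVlt nth_rcons => /orP[/eqP ->|ilt].
  by rewrite ltnn eqxx.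
by rewrite ilt h.
Qed.

Lemma pathprob_rcons s x z :
  pathprob K a (rcons (rcons s x) z) = pathprob K a (rcons s x) * K x z.
Proof.
case: s => [|x0 s] /=; first by rewrite big_ord1 big_ord0 mulr1.
rewrite !size_rcons big_ord_recr -mulrA; congr (_ * (_ * _)); last first.
  by rewrite -rcons_cons !nth_rcons /= !size_rcons ltnS leqnn ltnn eqxx nth_rcons ltnn eqxx.
apply: eq_bigr => i _; have ilt := ltn_ord i.
rewrite -rcons_cons !nth_rcons /= !size_rcons ilt.
by rewrite (leq_trans ilt).
Qed.

(** Induction on [j]: splitting by the next position [z] lengthens the cylinder by one point, so [s]
    and [x] must stay general. *)
Lemma markov_cyl j s x y :
  P (cyl (rcons s x) `&` [set w | X (size s + j)%N w = y]) =
  (P (cyl (rcons s x)) * nstep K j x y)%E.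
Proof.
elim: j s x => [|j IH] s x /=.
  rewrite addn0 cyl_rcons; have [->|xy] := eqVneq x y.
    by rewrite mule1 -setIA setIid.
  rewrite mule0 -setIA (_ : _ `&` [set w | X _ w = y] = set0) ?setI0 ?measure0 //.
  by apply/seteqP; split=> w //= [-> xy']; rewrite xy' eqxx in xy.
have -> : P (cyl (rcons s x) `&` [set w | X (size s + j.+1)%N w = y]) =
    (\esum_(z in [set: Zd dim]) ((pathprob K a (rcons s x))%:E
       * ((K x z)%:E * nstep K j z y)))%E.
  rewrite -[_ `&` _]setTI (_ : setT = [set w | setT (X (size s).+1 w)]) //.
  rewrite measure_countable_partition //; last first.
    by apply: measurableI => //; exact: measurable_cyl.
  apply: eq_esum => z _.
  rewrite setIA [X in X `&` _]setIC -(size_rcons s x) -cyl_rcons.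
  by rewrite addnS -addSn -{1}(size_rcons s x) IH chainP pathprob_rcons EFinM muleA.
rewrite esumZl ?chainP //.
  by rewrite -lee_fin -chainP.
by move=> z; rewrite mule_ge0 ?lee_fin // nstep_ge0.
Qed.

Lemma markov_trace n j x y (B : set (seq (Zd dim))) :
  fine (P [set w | B (trace n w) /\ X n w = x /\ X (n + j)%N w = y]) =
  fine (P [set w | B (trace n w) /\ X n w = x]) * stepr K j x y.
Proof.
have h : (P ([set w | B (trace n w)] `&` ([set w | X n w = x] `&` [set w | X (n + j)%N w = y]))
    = (stepr K j x y)%:E * P ([set w | B (trace n w)] `&` [set w | X n w = x]))%E.
  apply: measure_partition_proportional; rewrite ?stepr_ge0 //.
  - exact: cmeas_trace.
  - exact: measurableI.
  move=> s Bs; have [sn|sn] := eqVneq (size s) n.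
    by rewrite -sn setIA -cylE -cyl_rcons markov_cyl // steprE // muleC.
  have -> : [set w | trace n w = s] = set0.
    by apply/seteqP; split=> w //= ws; rewrite -ws size_mkseq eqxx in sn.
  by rewrite !set0I !measure0 mule0.
rewrite [X in P X](_ : _ = [set w | B (trace n w)] `&`
  ([set w | X n w = x] `&` [set w | X (n + j)%N w = y])) //.
rewrite h fineM ?fin_num_measure //; first by rewrite mulrC.
by apply: measurableI => //; apply: cmeas_preimage; exact: cmeas_trace.
Qed.

Lemma chain_law n x : fine (P [set w | X n w = x]) = stepr K n a x.
Proof.
have X0 : P (cyl [:: a]) = 1%E by rewrite chainP /= eqxx big_ord0 mulr1.
have := @markov_cyl n [::] a x; rewrite /= X0 mul1e => e.
rewrite /stepr -e; congr fine.
(* The chain starts at [a] only almost surely: the event is split along [X 0 = a], and the other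
   piece is null. *)
rewrite -[X in P X](setTI) -(setvU (cyl [:: a])) setIUl measureU; first last.
- by apply/seteqP; split=> w //= [[+ _] [+ _]].
- by apply: measurableI => //; exact: measurable_cyl.
- by apply: measurableI => //; apply: measurableC; exact: measurable_cyl.
rewrite [X in (X + _)%E](_ : _ = 0%E) ?add0e //.
apply: (subset_measure0 (B := ~` cyl [:: a])) => //.
- by apply: measurableI => //; apply: measurableC; exact: measurable_cyl.
- by apply: measurableC; exact: measurable_cyl.
apply: etrans (probability_setC P (measurable_cyl _)) _.
by rewrite X0 subee.
Qed.

End Chain.

(** * Dyadic cubes *)

Section Cubes.
Variable dim : nat.
Implicit Types x y z : Zd dim.

Lemma inV_mono k k' x : (k <= k')%N -> inV k x -> inV k' x.
Proof.
move=> kk' /forallP h; apply/forallP => i; have /andP[h1 h2] := h i.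
have e : ((2 ^ k)%:Z <= (2 ^ k')%:Z) by rewrite lez_nat leq_exp2l.
by rewrite (le_trans _ h1) ?lerN2 // (lt_le_trans h2).
Qed.

(** The search range in [shell] suffices: with [n] the sum of the absolute coordinates, each of them
    is at most [n < 2 ^ n]. *)
Lemma inV_shell x : inV (shell x) x.
Proof.
set n := (\sum_(i < dim) `|x i|%N)%N.
have hs : has (fun k => inV k x) (iota 0 n.+1).
  apply/hasP; exists n; first by rewrite mem_iota add0n ltnS leqnn.
  apply/forallP => i.
  have : (`|x i| < 2 ^ n)%N.
    apply: leq_ltn_trans (ltn_expl n (isT : 1 < 2)%N).
    by rewrite /n (bigD1 i) //= leq_addr.
  by move: (2 ^ n)%N => N; lia.
have := nth_find 0%N hs; rewrite nth_iota //.
by move: hs; rewrite has_find size_iota.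
Qed.

Lemma shell_min k x : inV k x -> (shell x <= k)%N.
Proof.
move=> hk; rewrite leqNgt; apply/negP => lt.
have := before_find 0%N lt; rewrite nth_iota ?add0n ?hk //.
by apply: leq_trans lt _; rewrite -[X in (_ <= X)%N](size_iota 0) find_size.
Qed.

Lemma inSE k x : inS k x = (shell x == k).
Proof.
apply/idP/eqP => [/andP[kx nk]|<-].
  apply/eqP; rewrite eqn_leq shell_min //=; case: k kx nk => [//|k] _.
  by rewrite ltnNge; apply: contra => /inV_mono; apply; exact: inV_shell.
rewrite /inS inV_shell /=; case e: (shell x) => [//|k'].
by apply/negP => /shell_min; rewrite e ltnn.
Qed.

Lemma sameshellE x y : sameshell x y = (shell x == shell y).
Proof. by rewrite /sameshell !inSE eqxx eq_sym. Qed.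

Definition cubes x : seq (idx dim) :=
  [seq (shell x, j, cubeidx j x) | j <- iota 0 (shell x).+1].

Lemma mem_cubes k j v x : ((k, j, v) \in cubes x) =
  [&& k == shell x, (j <= shell x)%N & v == cubeidx j x].
Proof.
apply/mapP/and3P => [[i]|[/eqP -> jk /eqP ->]].
  by rewrite mem_iota add0n ltnS => /= ik [-> -> ->]; rewrite !eqxx.
by exists j => //; rewrite mem_iota add0n ltnS.
Qed.

Lemma uniq_cubes x : uniq (cubes x).
Proof. by rewrite map_inj_uniq ?iota_uniq // => i j []. Qed.

(** Since [2 ^ j] divides [2 ^ k] for [j <= k], the endpoints of [V_k] are grid points, so a grid
    cube meeting [V_k] lies inside it. *)
Lemma valid_cubes x : all (@valid_idx dim) (cubes x).
Proof.
apply/allP => -[[k j] v]; rewrite mem_cubes => /and3P[/eqP -> jk /eqP ->] /=.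
rewrite jk /=; apply/forallP => i; rewrite ffunE.
have /forallP /(_ i) /andP := inV_shell x.
rewrite -(subnKC jk) expnD PoszM.
have D0 : 0 < (2 ^ j)%:Z by rewrite ltz_nat expn_gt0.
have := divz_eq (x i) (2 ^ j)%:Z.
have := modz_ge0 (x i) (lt0r_neq0 D0); have := ltz_pmod (x i) D0.
move: (divz _ _) (modz _ _) => q r.
move: (Posz (2 ^ j)) (Posz (2 ^ (shell x - j))) D0 => D E D0 rD r0 -> [lo hi].
have h1 : - E < q + 1 by rewrite -(ltr_pM2r D0); lia.
have h2 : q < E by rewrite -(ltr_pM2r D0); lia.
have h3 : 0 <= (q + E) * D by apply: mulr_ge0; lia.
have h4 : 0 <= (E - (q + 1)) * D by apply: mulr_ge0; lia.
by apply/andP; split; lia.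
Qed.

Lemma PiP_cubes (R : realType) (T : Type) (p : R) (U : idx dim -> T -> R) w x :
  PiP p U w x <-> forall c, c \in cubes x -> U c w < p.
Proof.
split=> [h [[k j] v]|h j jk]; last by apply: h; rewrite mem_cubes !eqxx jk.
by rewrite mem_cubes => /and3P[/eqP -> jk /eqP ->]; exact: h.
Qed.

(** Indices record the shell, so points of different shells share none. This lets one formula cover
    both energies. *)
Lemma count_cubes x y : count (fun c => c \in cubes y) (cubes x) =
  if sameshell x y then dd x y else 0%N.
Proof.
rewrite sameshellE count_map; case: eqP => [e|/eqP e].
  apply: eq_in_count => j; rewrite mem_iota add0n ltnS => /= jk.
  by rewrite mem_cubes e eqxx -e jk.
by rewrite (eq_count (a2 := pred0)) ?count_pred0 // => j /=;
  rewrite mem_cubes (negbTE e).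
Qed.

(* Lists the cubes of x from the coarsest to the finest, so that the points of
   one cube are the points whose key has a given prefix. *)
Definition zkey x : seqlexi nat :=
  shell x :: [seq pickle (cubeidx (shell x - i) x) | i <- iota 0 (shell x).+1].

Definition zle x y : bool := (zkey x <= zkey y)%O.

Lemma zle_total : total zle.
Proof. by move=> x y; exact: le_total. Qed.

Lemma zle_trans : transitive zle.
Proof. by move=> x y z; exact: le_trans. Qed.

(** Equal heads at both ends squeeze the middle head; the tails are then in order and the argument
    repeats. *)
Lemma lexi_take_convex m (s1 s2 s3 : seqlexi nat) :
  (s1 <= s2)%O -> (s2 <= s3)%O -> take m s1 = take m s3 -> take m s2 = take m s1.
Proof.
elim: m s1 s2 s3 => [|m IH] s1 s2 s3; first by rewrite !take0.
case: s1 s2 s3 => [|x1 s1] [|x2 s2] [|x3 s3] //=.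
rewrite !lexi_cons => /andP[l1 i1] /andP[l2 i2] [e1 e].
have e2 : x2 = x1 by apply/eqP; rewrite eq_le l1 e1 l2.
rewrite e2 lexx /= in i1; rewrite e2 -e1 lexx /= in i2.
by rewrite e2 (IH _ _ _ i1 i2 e).
Qed.

Lemma cubeidx_coarser j j' x y : (j <= j')%N ->
  cubeidx j x = cubeidx j y -> cubeidx j' x = cubeidx j' y.
Proof.
move=> jj' /ffunP e; apply/ffunP => i; have := e i; rewrite !ffunE => ei.
by rewrite -(subnKC jj') expnD PoszM !divzMA_ge0 // ei.
Qed.

Lemma zle_convex x y z c : zle z x -> zle x y ->
  c \in cubes z -> c \in cubes y -> c \in cubes x.
Proof.
case: c => [[k j] v] zx xy.
rewrite !mem_cubes => /and3P[/eqP -> jk /eqP ->] /and3P[/eqP e _ /eqP zy].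
(* For [u] in the shell of [z], these are the cubes of levels [shell z] down to [j]. With the
   leading shell entry they form a prefix of length [shell z - j + 2]. *)
pose tl (u : Zd dim) := [seq pickle (cubeidx (shell u - i) u)
  | i <- take (shell z - j).+1 (iota 0 (shell u).+1)].
have tk u : take (shell z - j).+2 (zkey u) = shell u :: tl u.
  by rewrite /tl map_take.
have pre : take (shell z - j).+2 (zkey z) = take (shell z - j).+2 (zkey y).
  rewrite !tk -e; congr (_ :: _); rewrite /tl -e; apply/eq_in_map => i.
  rewrite take_iota mem_iota => /andP[_ ilt]; congr pickle.
  by apply: (cubeidx_coarser _ zy); lia.
have px := lexi_take_convex zx xy pre; rewrite !tk in px.
have ex : shell x = shell z by exact: (congr1 (head 0%N) px).
have et : tl x = tl z by exact: (congr1 behead px).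
rewrite ex eqxx jk /=; apply/eqP; apply: esym.
have := congr1 (fun s => nth 0%N s (shell z - j)) et; rewrite /tl ex.
have sz : size (take (shell z - j).+1 (iota 0 (shell z).+1)) = (shell z - j).+1.
  by rewrite size_takel // size_iota ltnS leq_subr.
rewrite !(nth_map 0%N) ?sz // nth_take // nth_iota ?ltnS ?leq_subr // add0n.
by rewrite subKn // => /(pcan_inj pickleK).
Qed.

End Cubes.

(** * Finite targets *)

Lemma card_seq_sub_set (I : choiceType) (s0 s : seq I) : uniq s -> {subset s <= s0} ->
  #|[set c : seq_sub s0 | val c \in s]%SET| = size s.
Proof.
move=> us ss; rewrite cardE -(size_map val); apply: perm_size.
apply: uniq_perm => //; first by rewrite map_inj_uniq ?enum_uniq //; exact: val_inj.
move=> x; apply/mapP/idP => [[c]|xs]; first by rewrite mem_enum inE => cs ->.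
by exists (SeqSub (ss _ xs)) => //; rewrite mem_enum inE.
Qed.

Section FiniteTarget.
Context (R : realType) (dim : nat) (dT : measure_display) (T : measurableType dT).
Context (P : probability T R) (K : Zd dim -> Zd dim -> R) (X : nat -> T -> Zd dim).
Context (U : idx dim -> T -> R) (p : R) (a : Zd dim).
Hypothesis K_ge0 : forall x y, 0 <= K x y.
Hypothesis green_fin : forall x y, (green K x y < +oo)%E.
Hypothesis mX : forall n x, measurable [set w | X n w = x].
Hypothesis mU : forall q t, valid_idx q -> measurable [set w | U q w < t].
Hypothesis chainP : forall xs, P (cyl X a xs) = (pathprob K a xs)%:E.
Hypothesis indep : forall (xs : seq (Zd dim)) (s : seq (idx dim)) (t : idx dim -> R),
  uniq s -> all (@valid_idx dim) s ->
  P (cyl X a xs `&` [set w | forall q, q \in s -> U q w < t q])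
  = (P (cyl X a xs) * (\prod_(q <- s) unifcdf (t q))%:E)%E.
Hypotheses (p_gt0 : 0 < p) (p_le1 : p <= 1).

Variable F0 : seq (Zd dim).
Hypothesis uF0 : uniq F0.

Local Notation S := 'I_(size F0).
Definition pt (i : S) : Zd dim := nth a F0 i.
(** For a point outside [F0], [index] returns [size F0], which [insub] sends to [None]. *)
Definition code (z : Zd dim) : option S := insub (index z F0).
Definition allcubes : seq (idx dim) := flatten [seq cubes x | x <- F0].
Local Notation C := (seq_sub allcubes).
Definition anc (i : S) : {set C} := [set c | val c \in cubes (pt i)]%SET.

Lemma pt_mem i : pt i \in F0.
Proof. exact: mem_nth. Qed.

Lemma codeE z i : (code z == Some i) = (z == pt i).
Proof.
apply/eqP/eqP => [|->].
  rewrite /code; case: insubP => // j lt ej [<-]; rewrite /pt ej.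
  by rewrite nth_index // -index_mem.
by rewrite /code /pt index_uniq // valK.
Qed.

Lemma code_pt i : code (pt i) = Some i.
Proof. by apply/eqP; rewrite codeE. Qed.

Lemma sub_allcubes x : x \in F0 -> {subset cubes x <= allcubes}.
Proof. by move=> xF c cx; apply/flatten_mapP; exists x. Qed.

Lemma valid_allcubes (c : C) : valid_idx (val c).
Proof.
have /flatten_mapP[x _ cx] := valP c.
by have /allP := valid_cubes x; apply.
Qed.

Lemma card_ancI i j : #|anc i :&: anc j| =
  if sameshell (pt i) (pt j) then dd (pt i) (pt j) else 0%N.
Proof.
rewrite -count_cubes -size_filter.
rewrite -(@card_seq_sub_set _ allcubes [seq c <- cubes (pt i) | c \in cubes (pt j)]).
- by apply: eq_card => c; rewrite !inE mem_filter andbC.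
- by rewrite filter_uniq ?uniq_cubes.
- by move=> c; rewrite mem_filter => /andP[_]; apply: sub_allcubes; exact: pt_mem.
Qed.

Definition cfgof (w : T) : {ffun C -> bool} := [ffun c => U (val c) w < p].

Lemma opens_PiP i w : opens (anc i) (cfgof w) <-> PiP p U w (pt i).
Proof.
rewrite PiP_cubes; split=> [/forall_inP h c cx|h].
  have := h (SeqSub (sub_allcubes (pt_mem i) cx)).
  by rewrite inE ffunE /=; apply.
by apply/forall_inP => c; rewrite inE => /h; rewrite ffunE.
Qed.

(** * The trace on the target and its joint law with the percolation *)

Variable L : nat.
Local Notation OX := {ffun 'I_L -> option S}.

(* The trace on F0 of the first L steps; None stands for a point outside F0. *)
Definition codes (w : T) : OX := [ffun m : 'I_L => code (X m w)].

(** Extended to all times by the default [None] from the horizon [L] on. *)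
Definition at_time (n : nat) (v : OX) : option S :=
  if insub n is Some m then v m else None.

Definition wcodes (v : OX) : R := fine (P [set w | codes w = v]).

Lemma at_time_codes n w : (n < L)%N -> at_time n (codes w) = code (X n w).
Proof. by move=> nL; rewrite /at_time insubT /= ffunE. Qed.

Lemma codes_trace w :
  codes w = [ffun m : 'I_L => code (nth a (trace X L w) m)].
Proof. by apply/ffunP => m; rewrite !ffunE nth_mkseq. Qed.

Lemma cmeas_codes : cmeas codes.
Proof.
have := cmeas_comp (fun xs => [ffun m : 'I_L => code (nth a xs m)]) (cmeas_trace mX L).
by rewrite (_ : _ \o _ = codes) //; apply/funext => w; rewrite codes_trace.
Qed.

Lemma cmeas_cfgof : cmeas cfgof.
Proof.
move=> o; rewrite (_ : [set _ | _] =
  \bigcap_(c in [set: C]) [set w | (U (val c) w < p) = o c]); last first.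
  apply/seteqP; split=> w /=; first by move=> <- c _; rewrite /= ffunE.
  by move=> h; apply/ffunP => c; rewrite ffunE; exact: h.
apply: fin_bigcap_measurable => [|c _]; first exact: finite_finset.
case: (o c).
  by apply: mU; exact: valid_allcubes.
rewrite (_ : [set _ | _] = ~` [set w | U (val c) w < p]).
  by apply: measurableC; apply: mU; exact: valid_allcubes.
by apply/seteqP; split=> w /=; [move=> -> | move/negP/negbTE].
Qed.

Lemma sum_wcodes (f : pred OX) :
  \sum_v wcodes v * (f v)%:R = fine (P [set w | f (codes w)]).
Proof. by rewrite (measure_finite_preimage P f cmeas_codes). Qed.

Lemma wcodes_ge0 v : 0 <= wcodes v.
Proof. by rewrite fine_ge0. Qed.

(** Independence is assumed on path cylinders and lower-tail events. Summing over paths with the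
    same codes gives it for cubes required to be open, and [bernoulli_field] extends it to full
    configurations. *)
Lemma codes_cfgof_indep v o :
  fine (P [set w | (codes w, cfgof w) = (v, o)]) = wcodes v * bern p o.
Proof.
have mA : measurable [set w | codes w = v] by exact: cmeas_codes.
have ps (s : seq C) : uniq s ->
    P ([set w | codes w = v] `&` [set w | forall c, c \in s -> U (val c) w < p]) =
    (P [set w | codes w = v] * (p ^+ size s)%:E)%E.
  move=> us; pose B := [set xs | [ffun m : 'I_L => code (nth a xs m)] = v].
  have mop : measurable [set w | forall c : C, c \in s -> U (val c) w < p].
    have := cmeas_preimage [set o : {ffun C -> bool} | forall c, c \in s -> o c] cmeas_cfgof.
    congr measurable; apply/seteqP; split=> w /= h c /h; by rewrite ffunE.
  have -> : [set w | codes w = v] = [set w | B (trace X L w)].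
    by apply/seteqP; split=> w /=; rewrite codes_trace.
  rewrite muleC -[X in (_ * P X)%E]setIT.
  apply: measure_partition_proportional => //.
  - by rewrite exprn_ge0 // ltW.
  - exact: cmeas_trace.
  move=> xs _; rewrite setIT; have [xL|xL] := eqVneq (size xs) L; last first.
    have -> : [set w | trace X L w = xs] = set0.
      by apply/seteqP; split=> w //= ws; rewrite -ws size_mkseq eqxx in xL.
    by rewrite set0I measure0 mule0.
  rewrite -xL -(cylE X a).
  have -> : [set w | forall c, c \in s -> U (val c) w < p] =
      [set w | forall q, q \in [seq val c | c <- s] -> U q w < p].
    apply/seteqP; split=> w /= h => [q /mapP[c cs ->]|c cs]; first exact: h.
    by apply: h; exact: map_f.
  rewrite (indep xs (fun=> p)).
  - rewrite muleC; congr (_%:E * _)%E; rewrite big_map big_const_seq count_predT.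
    rewrite /unifcdf; have -> : Num.min 1 (Num.max 0 p) = p.
      by rewrite (max_idPr (ltW p_gt0)) (min_idPr p_le1).
    by rewrite -Monoid.iteropE.
  - by rewrite map_inj_uniq //; exact: val_inj.
  - by apply/allP => q /mapP[c _ ->]; exact: valid_allcubes.
have mev (c : C) : measurable [set w | U (val c) w < p].
  by apply: mU; exact: valid_allcubes.
have := bernoulli_field mA mev ps o.
rewrite [X in P X](_ : _ = [set w | (codes w, cfgof w) = (v, o)]).
  by move=> ->; rewrite fineM ?fin_num_measure.
by apply/seteqP; split=> w /= [h1 h2]; [rewrite h1 -h2 | split].
Qed.

Lemma jointE_event (f : OX -> {ffun C -> bool} -> bool) :
  jointE p wcodes (fun v o => (f v o)%:R) = fine (P [set w | f (codes w) (cfgof w)]).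
Proof.
have := measure_finite_preimage P (fun u => f u.1 u.2) (cmeas_pair cmeas_codes cmeas_cfgof).
move=> /= ->; rewrite /jointE /Ebern.
transitivity (\sum_u wcodes u.1 * bern p u.2 * (f u.1 u.2)%:R); last first.
  by apply: eq_bigr => -[v o] _; rewrite codes_cfgof_indep.
rewrite -(pair_bigA _ (fun v o => wcodes v * bern p o * (f v o)%:R)) /=.
apply: eq_bigr => v _; rewrite mulr_sumr; apply: eq_bigr => o _.
by rewrite mulrA.
Qed.

Definition hitset N : set T := [set w | exists n, [/\ (n < N)%N, X n w \in F0 & PiP p U w (X n w)]].

Lemma hit_codes N : (N <= L)%N ->
  [set w | hit anc at_time N (codes w) (cfgof w)] = hitset N.
Proof.
move=> NL; apply/seteqP; split=> w /=.
  move=> /existsP[m]; have mL := leq_trans (ltn_ord m) NL.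
  rewrite /isopen at_time_codes //; case e: (code _) => [i|//] /opens_PiP h.
  have /eqP Xm : X m w == pt i by rewrite -codeE e.
  by exists m; rewrite Xm pt_mem.
move=> [n [nN XF h]]; apply/existsP; exists (Ordinal nN) => /=.
rewrite at_time_codes ?(leq_trans nN) //.
have lt : (index (X n w) F0 < size F0)%N by rewrite index_mem.
have e : X n w = pt (Ordinal lt) by rewrite /pt /= nth_index.
by rewrite e code_pt /=; apply/opens_PiP; rewrite -e.
Qed.

Lemma measurable_hitset N : (N <= L)%N -> measurable (hitset N).
Proof.
move=> NL; rewrite -hit_codes //.
exact: (cmeas_preimage [set u | hit anc at_time N u.1 u.2]
          (cmeas_pair cmeas_codes cmeas_cfgof)).
Qed.

Lemma jointE_hit N : (N <= L)%N ->
  jointE p wcodes (fun v o => (hit anc at_time N v o)%:R) = fine (P (hitset N)).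
Proof. by move=> NL; rewrite jointE_event hit_codes. Qed.

Local Notation ka := (fun n i => stepr K n a (pt i)).
Local Notation ks := (fun n i j => stepr K n (pt i) (pt j)).
Local Notation ga := (fun i => greenr K a (pt i)).
Local Notation gr := (fun i j => greenr K (pt i) (pt j)).

Lemma codes_law n i : (n < L)%N ->
  \sum_v wcodes v * (at_time n v == Some i)%:R = ka n i.
Proof.
move=> nL; rewrite (sum_wcodes (fun v => at_time n v == Some i)).
rewrite -(chain_law K_ge0 mX chainP); congr (fine (P _)).
by apply/seteqP; split=> w /=; rewrite at_time_codes // codeE => /eqP.
Qed.

Lemma codes_markov n j x y (A : pred (option S)) : (n + j < L)%N ->
  \sum_v wcodes v * ([forall m : 'I_n, ~~ A (at_time m v)]
     && (at_time n v == Some x) && (at_time (n + j)%N v == Some y))%:R =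
  (\sum_v wcodes v * ([forall m : 'I_n, ~~ A (at_time m v)]
     && (at_time n v == Some x))%:R) * ks j x y.
Proof.
move=> njL; have nL : (n < L)%N by exact: leq_ltn_trans (leq_addr _ _) njL.
rewrite (sum_wcodes (fun v => [forall m : 'I_n, ~~ A (at_time m v)]
     && (at_time n v == Some x) && (at_time (n + j)%N v == Some y))).
rewrite (sum_wcodes (fun v => [forall m : 'I_n, ~~ A (at_time m v)]
     && (at_time n v == Some x))).
pose B := [set xs | forall m : 'I_n, ~~ A (code (nth a xs m))].
have BE w : [forall m : 'I_n, ~~ A (at_time m (codes w))] <-> B (trace X n w).
  split=> [/forallP h m|h].
    by have := h m; rewrite at_time_codes ?nth_mkseq // (ltn_trans _ nL).
  apply/forallP => m; have := h m.
  by rewrite at_time_codes ?nth_mkseq // (ltn_trans _ nL).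
have := markov_trace K_ge0 green_fin mX chainP n j (pt x) (pt y) B.
rewrite [X in P X](_ : _ = [set w | [forall m : 'I_n, ~~ A (at_time m (codes w))]
     && (at_time n (codes w) == Some x) && (at_time (n + j)%N (codes w) == Some y)]).
  rewrite [X in _ = fine (P X) * _](_ : _ =
    [set w | [forall m : 'I_n, ~~ A (at_time m (codes w))]
     && (at_time n (codes w) == Some x)]) //.
  apply/seteqP; split=> w /=; rewrite at_time_codes // codeE.
    by move=> [/BE -> ->]; rewrite eqxx.
  by move=> /andP[/BE ? /eqP].
apply/seteqP; split=> w /=; rewrite !at_time_codes // !codeE.
  by move=> [/BE -> [-> ->]]; rewrite !eqxx.
by move=> /andP[/andP[/BE ? /eqP ?] /eqP].
Qed.

(** Real-valued form of both energies together. Division by [0] gives [0] here, so it is used for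
    measures that vanish where the Green function from [a] does. *)
Definition finite_energy (mu : Zd dim -> R) : R :=
  \sum_(x <- F0) \sum_(y <- F0) greenr K x y / greenr K a y
    * p ^- (if sameshell x y then dd x y else 0) * mu x * mu y.

Lemma energy_pt (mu : Zd dim -> R) :
  energy p anc ga gr (fun i => mu (pt i)) = finite_energy mu.
Proof.
rewrite /finite_energy (big_nth a) big_mkord; apply: eq_bigr => i _.
rewrite (big_nth a) big_mkord; apply: eq_bigr => j _.
by rewrite card_ancI.
Qed.

Lemma hitset_lower (mu : Zd dim -> R) t : (forall x, 0 <= mu x) ->
  2 * t * (\sum_(y <- F0) mu y / greenr K a y * \sum_(n < L) stepr K n a y) <=
  fine (P (hitset L)) + 2 * t ^+ 2 * finite_energy mu.
Proof.
move=> mu0; rewrite -energy_pt -jointE_hit // (big_nth a) big_mkord.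
apply: (@hit_lower _ _ _ _ p anc wcodes at_time L ka ks ga gr) => //.
- exact: wcodes_ge0.
- exact: codes_law.
- exact: codes_markov.
- by move=> n i; exact: stepr_ge0.
- by move=> k i; exact: sum_stepr_le.
- by move=> k i j; exact: sum_stepr_le.
Qed.

Lemma hitset_upper N M : (N + M <= L)%N ->
  (forall x y, x \in F0 -> y \in F0 -> greenr K x y <= 2 * \sum_(j < M) stepr K j x y) ->
  exists nu : Zd dim -> R, [/\ forall x, 0 <= nu x,
    forall x, x \notin F0 -> nu x = 0,
    forall x, nu x <= greenr K a x,
    \sum_(x <- F0) nu x = fine (P (hitset N)) &
    finite_energy nu <= 128 * fine (P (hitset N))].
Proof.
move=> NML grM; have NL : (N <= L)%N by apply: leq_trans NML; exact: leq_addr.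
pose nu x := if code x is Some i then hitlaw p anc wcodes at_time N i else 0.
have nuE i : nu (pt i) = hitlaw p anc wcodes at_time N i by rewrite /nu code_pt.
have nu0 i : 0 <= hitlaw p anc wcodes at_time N i.
  exact: (hitlaw_ge0 anc at_time p_gt0 p_le1 wcodes_ge0).
exists nu; split.
- by move=> x; rewrite /nu; case: (code x).
- by move=> x xF; rewrite /nu /code insubN // index_mem.
- move=> x; rewrite /nu; case e: (code x) => [i|]; last exact: greenr_ge0.
  have /eqP -> : x == pt i by rewrite -codeE e.
  apply: (@hitlaw_le _ _ _ _ p anc wcodes at_time L ka ga) => //.
  + exact: wcodes_ge0.
  + exact: codes_law.
  + by move=> k j; exact: sum_stepr_le.
- rewrite -jointE_hit // -sum_hitlaw (big_nth a) big_mkord.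
  by apply: eq_bigr => i _; rewrite -nuE.
- rewrite -energy_pt -jointE_hit //.
  rewrite (_ : (fun i => nu (pt i)) = hitlaw p anc wcodes at_time N); last first.
    by apply/funext => i; rewrite nuE.
  apply: (@hit_upper _ _ _ _ p anc wcodes at_time L ka ks ga gr _ _ _ _ _ _ _ _ _
            (fun i j => zle (pt i) (pt j)) N M) => //.
  + exact: wcodes_ge0.
  + exact: codes_law.
  + exact: codes_markov.
  + by move=> n i; exact: stepr_ge0.
  + by move=> n i j; exact: stepr_ge0.
  + by move=> k i; exact: sum_stepr_le.
  + by move=> k i j; exact: sum_stepr_le.
  + by move=> i j; exact: zle_total.
  + by move=> i j k; exact: zle_trans.
  + move=> i j k ki ij; apply/fintype.subsetP => c; rewrite !inE => /andP[ck cj].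
    exact: zle_convex ki ij ck cj.
  + by move=> i j; apply: grM; exact: pt_mem.
Qed.

End FiniteTarget.

(** * Capacities *)

Section Capacity.
Context (R : realType) (dim : nat) (K : Zd dim -> Zd dim -> R) (p : R) (a : Zd dim).
Hypothesis K_ge0 : forall x y, 0 <= K x y.
Hypothesis green_fin : forall x y, (green K x y < +oo)%E.
Hypothesis p_gt0 : 0 < p.

Definition total_energy F0 mu : \bar R := (energyI K F0 mu a + energyIp K p F0 mu a)%E.

Lemma eratio_ge0 x y : (0 <= eratio (green K x y) (green K a y))%E.
Proof.
rewrite /eratio; case: ifP => _; first by case: ifP.
by rewrite lee_fin divr_ge0 // fine_ge0 // green_ge0.
Qed.

Lemma eratioM x y (r : R) : (greenr K a y = 0 -> r = 0) ->
  (eratio (green K x y) (green K a y) * r%:E = (greenr K x y / greenr K a y * r)%:E)%E.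
Proof.
move=> h; rewrite /eratio !greenrE // !eqe.
have [e|_] := eqVneq (greenr K a y) 0; last by rewrite EFinM.
by rewrite (h e) mule0 mulr0.
Qed.

Lemma total_energy_fin F0 (mu : Zd dim -> R) :
  (forall y, y \in F0 -> greenr K a y = 0 -> mu y = 0) ->
  total_energy F0 mu = (finite_energy K p a F0 mu)%:E.
Proof.
move=> h; rewrite /total_energy /energyI /energyIp.
pose e x y := greenr K x y / greenr K a y
  * p ^- (if sameshell x y then dd x y else 0) * mu x * mu y.
transitivity ((\sum_(x <- F0) \sum_(y <- F0 | ~~ sameshell x y) (e x y)%:E)
  + \sum_(x <- F0) \sum_(y <- F0 | sameshell x y) (e x y)%:E)%E.
  congr (_ + _)%E; apply: eq_bigr => x _; rewrite big_seq_cond [RHS]big_seq_cond;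
    apply: eq_bigr => y /andP[yF sxy]; rewrite eratioM; rewrite /e ?sxy ?(negbTE sxy).
  - by congr _%:E; rewrite expr0 invr1; ring.
  - by move=> /(h _ yF) ->; rewrite mulr0.
  - by congr _%:E; ring.
  - by move=> /(h _ yF) ->; rewrite mulr0.
rewrite -big_split /= /finite_energy -sumEFin; apply: eq_bigr => x _.
by rewrite -sumEFin [RHS](bigID (sameshell x)) /= addeC.
Qed.

Lemma total_energy_ge0 F0 (mu : Zd dim -> R) : (forall x, 0 <= mu x) ->
  (0 <= total_energy F0 mu)%E.
Proof.
move=> mu0; rewrite /total_energy; apply: adde_ge0;
  apply: sume_ge0 => x _; apply: sume_ge0 => y _; rewrite mule_ge0 ?eratio_ge0 //.
  by rewrite lee_fin mulr_ge0.
by rewrite lee_fin !mulr_ge0 // invr_ge0 exprn_ge0 // ltW.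
Qed.

(** The diagonal term at [y] is already infinite, because [g(y,y) >= 1] is divided by [0]. *)
Lemma total_energy_pinfty F0 (mu : Zd dim -> R) y : (forall x, 0 <= mu x) ->
  uniq F0 -> y \in F0 -> mu y != 0 -> greenr K a y = 0 ->
  total_energy F0 mu = +oo%E.
Proof.
move=> mu0 uF yF muy g0; apply/eqP; rewrite -leye_eq.
have muy0 : 0 < mu y by rewrite lt_neqAle eq_sym muy mu0.
have t0 x z : (0 <= eratio (green K x z) (green K a z) * (p ^- dd x z * mu x * mu z)%:E)%E.
  by rewrite mule_ge0 ?eratio_ge0 // lee_fin !mulr_ge0 // invr_ge0 exprn_ge0 // ltW.
have -> : (+oo = eratio (green K y y) (green K a y) * (p ^- dd y y * mu y * mu y)%:E)%E.
  rewrite /eratio !greenrE // g0 eqxx eqe gt_eqF; last first.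
    exact: lt_le_trans (greenr_diag K_ge0 green_fin y).
  by rewrite gt0_mulye // lte_fin !mulr_gt0 // invr_gt0 exprn_gt0.
rewrite /total_energy addeC; apply: lee_paddr.
  by apply: sume_ge0 => x _; apply: sume_ge0 => z _;
    rewrite mule_ge0 ?eratio_ge0 // lee_fin mulr_ge0.
rewrite /energyIp (bigD1_seq y) //=; apply: lee_paddr.
  by apply: sume_ge0 => x _; apply: sume_ge0.
rewrite big_mkcond (bigD1_seq y) //= sameshellE eqxx; apply: lee_paddr => //.
by apply: sume_ge0 => z _; case: ifP.
Qed.

Lemma einv_le (e : \bar R) (h : R) : 0 < h -> (h^-1%:E <= e)%E -> (einv e <= h%:E)%E.
Proof.
move=> h0; rewrite /einv; case: e => [r| |] /=.
- rewrite lee_fin => hr; have r0 : 0 < r by apply: lt_le_trans hr; rewrite invr_gt0.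
  by rewrite eqe gt_eqF // lee_fin -[leRHS]invrK lef_pV2 // posrE invr_gt0.
- by move=> _; rewrite lee_fin ltW.
- by [].
Qed.

Lemma einv_ge (e : \bar R) (h : R) : 0 < h -> (0 <= e)%E -> (e <= h^-1%:E)%E ->
  (h%:E <= einv e)%E.
Proof.
move=> h0; rewrite /einv; case: e => [r| |] //=.
rewrite !lee_fin eqe => r0 rh; case: eqP => [_|/eqP rn0]; first by rewrite leey.
by rewrite lee_fin -[leLHS]invrK lef_pV2 // posrE ?invr_gt0 // lt_neqAle eq_sym rn0.
Qed.

Lemma capacity_ge0 (F : set (Zd dim)) : (0 <= capacity K p F a)%E.
Proof.
(* The empty list carries no probability measure: the infimum is [+oo] and its inverse [0]. *)
apply: ereal_sup_ubound; exists [::] => //=.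
rewrite (_ : [set _ | _ in _] = set0) ?ereal_inf0 /einv ?eqxx //.
apply/seteqP; split=> // r [mu [_ [_]]]; rewrite big_nil => /eqP.
by rewrite eq_sym oner_eq0.
Qed.

(** Here [h] plays the hitting probability and [r] a finite energy. If [h > 0], taking [t = h] gives
    [r >= 1 / (2 h)]; if [h = 0], a small [t] rules out finite energies altogether. *)
Lemma capacity_le (F : set (Zd dim)) (h : R) : 0 <= h ->
  (forall F0 mu r t, uniq F0 -> (forall x, x \in F0 -> F x) -> M1 F0 mu ->
     (forall y, y \in F0 -> greenr K a y = 0 -> mu y = 0) ->
     finite_energy K p a F0 mu = r -> 0 <= t -> 2 * t <= h + 2 * t ^+ 2 * r) ->
  (capacity K p F a <= (2 * h)%:E)%E.
Proof.
move=> h0 hyp; apply: ge_ereal_sup => _ [F0 [uF sF] <-].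
have fin mu : M1 F0 mu -> total_energy F0 mu = +oo%E \/
    exists2 r, total_energy F0 mu = r%:E & forall t, 0 <= t -> 2 * t <= h + 2 * t ^+ 2 * r.
  move=> mM; have [mu0 [mus mu1]] := mM.
  have [ex|no] := pselect (exists2 y, y \in F0 & mu y != 0 /\ greenr K a y = 0).
    by have [y yF [my gy]] := ex; left; exact: (@total_energy_pinfty _ _ y).
  have nz y : y \in F0 -> greenr K a y = 0 -> mu y = 0.
    by move=> yF gy; apply/eqP; apply: contrapT => /negP my; apply: no; exists y.
  right; exists (finite_energy K p a F0 mu); first exact: total_energy_fin.
  by move=> t t0; exact: (hyp F0 mu).
have [hp|hz] := ltP 0 h.
  apply: einv_le; first by lra.
  apply: le_ereal_inf_tmp => _ [mu mM <-]; rewrite -/(total_energy F0 mu).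
  case: (fin mu mM) => [->|[r -> hr]]; first by rewrite leey.
  have := hr h (ltW hp); rewrite lee_fin => hh.
  by rewrite -[leLHS]mul1r ler_pdivrMr ?mulr_gt0 //; nra.
have {hz} hE : h = 0 by lra.
rewrite (_ : ereal_inf _ = +oo%E) ?/einv ?eqxx ?hE ?mulr0 //.
apply/eqP; rewrite -leye_eq; apply: le_ereal_inf_tmp => _ [mu mM <-].
rewrite -/(total_energy F0 mu).
case: (fin mu mM) => [->//|[r _ hr]].
(* For [h = 0] and [t > 0] the hypothesis says [1 <= t r], but this [t] makes [t r] less than
   [1/2]. *)
exfalso; have := hr ((2 * (`|r| + 1))^-1).
have r0 := normr_ge0 r; have rr := ler_norm r.
have s0 : 0 < (2 * (`|r| + 1))^-1 by rewrite invr_gt0; lra.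
have se : (2 * (`|r| + 1))^-1 * (2 * (`|r| + 1)) = 1 by rewrite mulVf // gt_eqF //; lra.
move: (2 * (`|r| + 1))^-1 s0 se => s s0 se /(_ (ltW s0)); rewrite hE; nra.
Qed.

(** Dividing [nu] by its mass [h] gives a probability measure whose energy is smaller by [h ^+ 2],
    hence at most [c / h]. *)
Lemma capacity_ge (F : set (Zd dim)) F0 (nu : Zd dim -> R) (h c : R) :
  uniq F0 -> (forall x, x \in F0 -> F x) -> 0 < h -> 0 < c ->
  (forall x, 0 <= nu x) -> (forall x, x \notin F0 -> nu x = 0) ->
  (forall y, nu y <= greenr K a y) ->
  \sum_(x <- F0) nu x = h -> finite_energy K p a F0 nu <= c * h ->
  (h%:E <= c%:E * capacity K p F a)%E.
Proof.
move=> uF sF h0 c0 nu0 nus nug nuh eng.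
rewrite -lee_pdivrMl // -EFinM.
apply: le_trans (ereal_sup_ubound _); last by exists F0; [split|].
apply: einv_ge; first by rewrite mulr_gt0 // invr_gt0.
  apply: le_ereal_inf_tmp => _ [mu [mu0 _] <-]; exact: total_energy_ge0.
apply: ereal_inf_le; pose mu x := nu x / h.
exists (total_energy F0 mu); first exists mu => //.
  split; first by move=> x; rewrite divr_ge0 // ltW.
  split; first by move=> x /nus; rewrite /mu => ->; rewrite mul0r.
  by rewrite -mulr_suml nuh divff // gt_eqF.
rewrite total_energy_fin.
  rewrite lee_fin (_ : finite_energy _ _ _ _ mu = finite_energy K p a F0 nu / h ^+ 2); last first.
    rewrite /finite_energy mulr_suml; apply: eq_bigr => x _.
    rewrite mulr_suml; apply: eq_bigr => y _; rewrite /mu expr2 invfM; ring.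
  by rewrite ler_pdivrMr ?exprn_gt0 // invfM invrK expr2 mulrA divfK // gt_eqF.
move=> y _ g0; rewrite /mu; have := nug y; have := nu0 y; rewrite g0.
by move=> ? ?; rewrite (_ : nu y = 0) ?mul0r //; lra.
Qed.

End Capacity.

(** * Exhaustion by finite targets and horizons *)

Theorem theorem5p1 (R : realType) (dim : nat) (dT : measure_display)
  (T : measurableType dT) (P : probability T R)
  (K : Zd dim -> Zd dim -> R)
  (X : nat -> T -> Zd dim) (U : idx dim -> T -> R)
  (p : R) (F : set (Zd dim)) (a : Zd dim) :
  (0 < dim)%N ->
  (* transition kernel *)
  (forall x y, 0 <= K x y) ->
  (forall x, (\esum_(y in [set: Zd dim]) (K x y)%:E)%E = 1%E) ->
  (* transience *)
  (forall x y, (green K x y < +oo)%E) ->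
  (* measurability *)
  (forall n x, measurable [set w | X n w = x]) ->
  (forall q t, valid_idx q -> measurable [set w | U q w < t]) ->
  (* under P = P^a, X is a Markov chain with kernel K started at a *)
  (forall xs : seq (Zd dim),
     P [set w | forall i, (i < size xs)%N -> X i w = nth a xs i]
     = (pathprob K a xs)%:E) ->
  (* the U's are i.i.d. Uniform(0,1) and independent of X *)
  (forall (xs : seq (Zd dim)) (s : seq (idx dim)) (t : idx dim -> R),
     uniq s -> all (@valid_idx dim) s ->
     P ([set w | forall i, (i < size xs)%N -> X i w = nth a xs i]
        `&` [set w | forall q, q \in s -> U q w < t q])
     = (P [set w | forall i, (i < size xs)%N -> X i w = nth a xs i]
        * (\prod_(q <- s) unifcdf (t q))%:E)%E) ->
  0 < p <= 1 ->
  ((2^-1)%:E * capacity K p F a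
     <= P [set w | exists n, PiP p U w (X n w) /\ F (X n w)])%E /\
  (P [set w | exists n, PiP p U w (X n w) /\ F (X n w)]
     <= 128%:E * capacity K p F a)%E.
Proof.
move=> _ K0 _ gfin mX mU chainP indep /andP[p0 p1].
set H := [set w | _].
(* The points of [F] with code below [N]; target and time horizon grow together. *)
pose FN N := undup [seq x <- pmap unpickle (iota 0 N) | `[< F x >]].
pose HN N := hitset X U p (FN N) N.
have uFN N : uniq (FN N) by exact: undup_uniq.
have FNF N x : x \in FN N -> F x by rewrite mem_undup mem_filter => /andP[/asboolP].
have hitH F0 N : (forall x, x \in F0 -> F x) -> hitset X U p F0 N `<=` H.
  by move=> FF w [n [_ XF h]]; exists n; split=> //; exact: FF.
have mhit F0 N : uniq F0 -> measurable (hitset X U p F0 N).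
  by move=> uF; exact: (measurable_hitset p a mX mU uF (leqnn N)).
have HE : H = \bigcup_N HN N.
  apply/seteqP; split=> w /=; last by move=> [N _]; apply: hitH; exact: FNF.
  move=> [n [h Fn]]; exists (maxn n.+1 (pickle (X n w)).+1) => //.
  exists n; split=> //; first by rewrite leq_max ltnSn.
  rewrite mem_undup mem_filter; apply/andP; split; first exact/asboolP.
  rewrite mem_pmap; apply/mapP; exists (pickle (X n w)); last by rewrite pickleK.
  by rewrite mem_iota add0n leq_max ltnSn orbT.
have mHN N : measurable (HN N) by exact: mhit.
have mH : measurable H by rewrite HE; exact: bigcup_measurable.
have PHfin : P H = (fine (P H))%:E by rewrite fineK // fin_num_measure.
split.
  have cap : (capacity K p F a <= (2 * fine (P H))%:E)%E.
    apply: capacity_le => //; first exact: fine_ge0.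
    move=> F0 mu r t uF FF [mu0 [_ mu1]] nz er t0.
    apply/ler_addgt0Pr => e e0.
    (* Truncating the Green function at [L] loses a factor [1 - e'], which costs [2 t e' <= e]; the
       [+ 1] covers [t = 0]. *)
    have e'0 : 0 < e / (2 * t + 1) by rewrite divr_gt0 //; lra.
    have e'e : 2 * t * (e / (2 * t + 1)) <= e.
      by rewrite mulrA ler_pdivrMr; nra.
    move: (e / (2 * t + 1)) e'0 e'e => e' e'0 e'e.
    have [L hL] := sum_stepr_approx K0 gfin (a :: F0) e'0.
    have := @hitset_lower _ _ _ _ P K X U p a K0 gfin mX mU chainP indep p0 p1 F0 uF L mu t mu0.
    rewrite er.
    have : fine (P (hitset X U p F0 L)) <= fine (P H).
      apply: fine_le; rewrite ?fin_num_measure //; first exact: mhit.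
      by apply: le_measure; rewrite ?inE //; [exact: mhit | exact: hitH].
    have : 1 - e' <=
        \sum_(y <- F0) mu y / greenr K a y * \sum_(n < L) stepr K n a y.
      rewrite -[leLHS]mulr1 -[X in _ * X <= _]mu1 mulr_sumr big_seq [leRHS]big_seq.
      apply: ler_sum => y yF; have [g0|g0] := eqVneq (greenr K a y) 0.
        by rewrite (nz y yF g0) mul0r mulr0 mul0r.
      have {}g0 : 0 < greenr K a y by rewrite lt_neqAle eq_sym g0 greenr_ge0.
      have := hL a y; rewrite !inE eqxx yF orbT => /(_ isT isT) h.
      apply: (@le_trans _ _ (mu y / greenr K a y * ((1 - e') * greenr K a y))).
        by rewrite [leRHS]mulrCA divfK // lt0r_neq0.
      by rewrite ler_wpM2l // divr_ge0 // ltW.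
    move: (\sum_(y <- F0) _) => m; nra.
  rewrite PHfin; apply: (@le_trans _ _ ((2^-1)%:E * (2 * fine (P H))%:E)%E).
    by rewrite lee_wpmul2l // lee_fin invr_ge0.
  by rewrite -EFinM lee_fin mulKf.
have up N : (P (HN N) <= 128%:E * capacity K p F a)%E.
  have [h0|h0] := eqVneq (fine (P (HN N))) 0.
    rewrite -(fineK (fin_num_measure P _ (mHN N))) h0 mule_ge0 //.
    exact: capacity_ge0.
  have hp : 0 < fine (P (HN N)) by rewrite lt_neqAle eq_sym h0 fine_ge0.
  (* Relative error [1/2] yields the factor 2 required of the truncation. The horizon is [N + M]:
     [N] steps for the first hit and [M] for the visits after it. *)
  have [M hM] := sum_stepr_approx K0 gfin (FN N) (e := 2^-1) ltac:(lra).
  have grM x y : x \in FN N -> y \in FN N ->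
      greenr K x y <= 2 * \sum_(j < M) stepr K j x y.
    by move=> xF yF; have := hM x y xF yF; lra.
  have [nu [nu0 nus nug nuh eng]] := @hitset_upper _ _ _ _ P K X U p a K0 gfin mX mU
    chainP indep p0 p1 (FN N) (uFN N) (N + M)%N N M (leqnn _) grM.
  rewrite -(fineK (fin_num_measure P _ (mHN N))).
  by apply: (@capacity_ge _ _ K p a K0 gfin p0 F (FN N) nu) => //; exact: FNF.
(* The bound is uniform in [N], so it passes to the increasing union by continuity from below. *)
have cv : P (HN N) @[N --> \oo] --> P (\bigcup_N HN N).
  apply: nondecreasing_cvg_mu => //; first exact: bigcup_measurable.
  move=> m n mn; apply/subsetPset => w [k [km XF h]].
  exists k; split=> //; first exact: leq_trans mn.
  move: XF; rewrite !mem_undup !mem_filter => /andP[-> /=].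
  rewrite !mem_pmap => /mapP[i im e]; apply/mapP; exists i => //.
  by move: im; rewrite !mem_iota !add0n => /leq_trans; apply.
rewrite HE -(cvg_lim _ cv) //; apply: lime_le; first by apply/cvg_ex; eexists; exact: cv.
exact: nearW.
Qed.
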